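(* Let $s \geq 1$ and let $\emptyset \neq K \subset \mathbb{R}^{2}$ be a bounded $\mathcal{H}^{s}$-measurable $s$-Ahlfors-David-regular set. Then there exists a point $x_{0} \in K$ such that $$\overline{\dim}_{\mathrm{B}} \bigl(K \cdot (K - x_{0})\bigr) = 1,$$ where $K \cdot (K - x_{0}) = \{x_{1} \cdot (x_{2} - x_{0}) : x_{1},x_{2} \in K\} \subset \mathbb{R}$ and $\cdot$ between vectors denotes the Euclidean inner product on $\mathbb{R}^{2}$.
   Context: Ahlfors-David regularity. Let $C \geq 1$. A Borel measure $\mu$ on $\mathbb{R}^{d}$ is $(s,C)$-Ahlfors-David regular if $r^{s}/C \leq \mu(B(x,r)) \leq C r^{s}$ for all $x \in \operatorname{spt} \mu$ and $0 < r \leq \operatorname{diam}(\operatorname{spt} \mu)$. An $\mathcal{H}^{s}$-measurable set $K \subset \mathbb{R}^{d}$ is $(s,C)$-Ahlfors-David regular if $0 < \mathcal{H}^{s}(K) < \infty$ and the restriction $\mathcal{H}^{s}|_{K}$ of $s$-dimensional Hausdorff measure to $K$ is an $(s,C)$-Ahlfors-David regular measure. $K$ is $s$-Ahlfors-David regular if it is $(s,C)$-Ahlfors-David regular for some $C \geq 1$. Upper box dimension. For bounded $B \subset \mathbb{R}^{d}$, let $N(B,\delta)$ be the least number of $\delta$-balls needed to cover $B$, and let $\overline{\dim}_{\mathrm{B}} B := \limsup_{\delta \to 0} \frac{\log N(B,\delta)}{-\log \delta}$. *)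

(* Defs.v *)
From HB Require Import structures.
From mathcomp Require Import all_boot all_order all_algebra.
From mathcomp Require Import all_classical all_reals all_analysis.

Set Implicit Arguments.
Unset Strict Implicit.
Unset Printing Implicit Defensive.

Import Order.TTheory GRing.Theory Num.Theory.
Import numFieldNormedType.Exports.

Local Open Scope classical_set_scope.
Local Open Scope ring_scope.

(* The library norm on ['rV[R]_d] is the sup norm; the Euclidean structure of
   R^d is introduced here.  Both define the same topology and the same bounded
   sets, for which the library notions are used. *)
Section euclidean.
Context {R : realType} {d : nat}.
Implicit Types (u v x y : 'rV[R]_d) (A : set 'rV[R]_d).

Definition dotr u v : R := \sum_(i < d) u ord0 i * v ord0 i.

Definition enorm u : R := Num.sqrt (dotr u u).

Definition ecball x (r : R) : set 'rV[R]_d := [set y | enorm (y - x) <= r].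

(* [ediam set0 = -oo] *)
Definition ediam A : \bar R :=
  ereal_sup [set (enorm (p.1 - p.2))%:E | p in A `*` A].

Lemma normr_le_enorm u : `|u| <= enorm u.
Proof.
have s0 (P : pred 'I_d) : 0 <= \sum_(j < d | P j) u ord0 j * u ord0 j.
  by apply: sumr_ge0 => j _; rewrite -expr2 sqr_ge0.
have [u0|/mx_norm_neq0[[i j] /= uij]] := eqVneq (mx_norm u) 0.
  by rewrite [leLHS]u0 sqrtr_ge0.
rewrite [leLHS]uij (ord1 i) -sqrtr_sqr; apply: ler_wsqrtr.
by rewrite /dotr (bigD1 j)//= -expr2 lerDl.
Qed.

End euclidean.

Section hausdorff_measure.
Context {R : realType} {d : nat}.
Local Open Scope ereal_scope.
Implicit Types (s delta : R) (A B U : set 'rV[R]_d).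

(* [diam(U)^s], with the convention that the empty set contributes 0, also for
   [s = 0] *)
Definition diam_pow s U : \bar R :=
  if U == set0 then 0 else poweR (ediam U) s.

Definition hausdorff_premeasure s delta A : \bar R :=
  ereal_inf [set \sum_(i <oo) diam_pow s (U i) | U in
    [set U : (set 'rV[R]_d)^nat |
      A `<=` \bigcup_i U i /\ forall i, ediam (U i) <= delta%:E]].

Definition hausdorff_measure s A : \bar R :=
  ereal_sup [set hausdorff_premeasure s delta A | delta in [set t : R | (0 < t)%R]].

Let G : set (set 'rV[R]_d) := setT.
Let gauge s delta U := if ediam U <= delta%:E then diam_pow s U else +oo.

Let diam_pow_ge0 s U : 0 <= diam_pow s U.
Proof. by rewrite /diam_pow; case: ifP => // _; exact: poweR_ge0. Qed.

Let gauge_ge0 s delta U : 0 <= gauge s delta U.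
Proof. by rewrite /gauge; case: ifP => // _; rewrite leey. Qed.

Lemma ediam0 : ediam (set0 : set 'rV[R]_d) = -oo.
Proof. by rewrite /ediam setX0 image_set0 ereal_sup0. Qed.

Let gauge0 s delta : gauge s delta set0 = 0.
Proof. by rewrite /gauge ediam0 leNye /diam_pow eqxx. Qed.

Let hausdorff_premeasureE s delta :
  hausdorff_premeasure s delta =
  @mu_ext _ (g_sigma_algebraType G) R (gauge s delta).
Proof.
apply/funext => A; rewrite /hausdorff_premeasure /mu_ext.
apply/eqP; rewrite eq_le; apply/andP; split; apply: le_ereal_inf_tmp.
- move=> _ [U [_ AU] <-].
  have [Ud|] := pselect (forall i, ediam (U i) <= delta%:E).
    apply: ereal_inf_lbound; exists U => //.
    by apply: eq_eseriesr => i _; rewrite /gauge Ud.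
  move=> /existsNP[i /negP Ui]; rewrite (@eseries_pinfty _ _ xpredT i) ?leey//.
  + by move=> n _; rewrite -ltNye (lt_le_trans _ (gauge_ge0 _ _ _)).
  + by rewrite /gauge (negbTE Ui).
- move=> _ [U [AU Ud] <-]; apply: ereal_inf_lbound; exists U => /=.
    by split=> // i; exact: sub_sigma_algebra.
  by apply: eq_eseriesr => i _; rewrite /gauge Ud.
Qed.

Lemma hausdorff_measure0 s : hausdorff_measure s set0 = 0.
Proof.
rewrite /hausdorff_measure (_ : [set _ | _ in _] = [set 0]) ?ereal_sup1//.
have H t : hausdorff_premeasure s t set0 = 0.
  rewrite hausdorff_premeasureE; apply: mu_ext0; [exact: gauge0|exact: gauge_ge0].
apply/seteqP; split=> [_ [t _ <-]|_ ->] /=; first exact: H.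
by exists 1%R => //=.
Qed.

Let premeasure_ge0 s delta A : 0 <= hausdorff_premeasure s delta A.
Proof. by rewrite hausdorff_premeasureE; apply: mu_ext_ge0; exact: gauge_ge0. Qed.

Let premeasure_le s delta A : (0 < delta)%R ->
  hausdorff_premeasure s delta A <= hausdorff_measure s A.
Proof. by move=> d0; apply: ereal_sup_ubound; exists delta. Qed.

Lemma hausdorff_measure_ge0 s A : 0 <= hausdorff_measure s A.
Proof. exact: le_trans (premeasure_ge0 s 1 A) (premeasure_le _ _ _). Qed.

Lemma le_hausdorff_measure s :
  {homo hausdorff_measure s : A B / A `<=` B >-> A <= B}.
Proof.
move=> A B AB; apply: ge_ereal_sup => _ [t t0 <-].
apply: le_trans (premeasure_le s B t0).
by rewrite hausdorff_premeasureE; exact: le_mu_ext.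
Qed.

Lemma hausdorff_measure_sigma_subadditive s :
  sigma_subadditive (hausdorff_measure s).
Proof.
move=> F; apply: ge_ereal_sup => _ [t t0 <-].
apply: (@le_trans _ _ (\sum_(i <oo) hausdorff_premeasure s t (F i))).
  rewrite hausdorff_premeasureE.
  by apply: mu_ext_sigma_subadditive; exact: gauge_ge0.
by apply: lee_nneseries => // i _; exact: premeasure_le.
Qed.

HB.instance Definition _ s := isOuterMeasure.Build R 'rV[R]_d
  (hausdorff_measure s) (hausdorff_measure0 s) (hausdorff_measure_ge0 s)
  (@le_hausdorff_measure s) (@hausdorff_measure_sigma_subadditive s).

Let le_premeasure s t u A : (t <= u)%R ->
  hausdorff_premeasure s u A <= hausdorff_premeasure s t A.
Proof.
move=> tu; apply: le_ereal_inf_tmp => _ [U [AU Ut] <-].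
apply: ereal_inf_lbound; exists U => //; split=> // i.
by rewrite (le_trans (Ut i))// lee_fin.
Qed.

Lemma hausdorff_measure_metric s A B (e : R) : (0 < e)%R ->
  (forall x y, A x -> B y -> (e <= `|x - y|)%R) ->
  hausdorff_measure s A + hausdorff_measure s B <=
  hausdorff_measure s (A `|` B).
Proof.
move=> e0 AB.
have key t : (0 < t < e)%R ->
    hausdorff_premeasure s t A + hausdorff_premeasure s t B <=
    hausdorff_measure s (A `|` B).
  move=> /andP[t0 te]; apply: le_trans (premeasure_le _ _ t0).
  apply: le_ereal_inf_tmp => _ [U [ABU Ut] <-].
  pose V C i : set 'rV[R]_d := if U i `&` C == set0 then set0 else U i.
  have VC C : C `<=` A `|` B ->
      hausdorff_premeasure s t C <= \sum_(i <oo) diam_pow s (V C i).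
    move=> CAB; apply: ereal_inf_lbound; exists (V C) => //; split.
      move=> x Cx; have [i _ Uix] := ABU _ (CAB _ Cx).
      exists i => //; rewrite /V; case: ifPn => // /eqP UC0.
      by have : (U i `&` C) x by []; rewrite UC0.
    by move=> i; rewrite /V; case: ifPn => // _; rewrite ediam0 leNye.
  apply: (le_trans (leeD (VC A _) (VC B _))); [by left|by right|].
  rewrite -nneseriesD//; apply: lee_nneseries => i _; first by move=> _; exact: adde_ge0.
  have V0 : diam_pow s set0 = 0 by rewrite /diam_pow eqxx.
  rewrite /V; case: ifPn => [_|/set0P[x [Ux Ax]]]; rewrite ?V0 ?add0e.
    by case: ifPn => // _; rewrite V0.
  case: ifPn => [_|/set0P[y [Uy By]]]; rewrite ?V0 ?adde0//.
  have : (enorm (x - y))%:E <= t%:E.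
    apply: le_trans (Ut i); apply: ereal_sup_ubound.
    by exists (x, y).
  rewrite lee_fin leNgt (lt_le_trans te)//.
  exact: le_trans (AB _ _ Ax By) (normr_le_enorm _).
have {}key t u : (0 < t)%R -> (0 < u)%R ->
    hausdorff_premeasure s t A + hausdorff_premeasure s u B <=
    hausdorff_measure s (A `|` B).
  move=> t0 u0; pose v := (Num.min (Num.min t u) (e / 2))%R.
  have v0 : (0 < v)%R by rewrite !lt_min t0 u0 divr_gt0.
  apply: le_trans (key v _); last first.
    rewrite v0/= gt_min; apply/orP; right.
    by rewrite ltr_pdivrMr// ltr_pMr// ltr1n.
  by apply: leeD; apply: le_premeasure; rewrite !ge_min lexx ?orbT.
have [->|AoB] := eqVneq (hausdorff_measure s (A `|` B)) +oo; first exact: leey.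
have Af C : C `<=` A `|` B -> hausdorff_measure s C \is a fin_num.
  move=> CAB; rewrite ge0_fin_numE ?hausdorff_measure_ge0//.
  by rewrite (le_lt_trans (le_hausdorff_measure s CAB))// ltey.
have Aff := Af A (@subsetUl _ _ _); have Bff := Af B (@subsetUr _ _ _).
rewrite -leeBrDr//; apply: ge_ereal_sup => _ [t t0 <-].
have tf : hausdorff_premeasure s t A \is a fin_num.
  rewrite ge0_fin_numE// (le_lt_trans (premeasure_le _ _ t0))//.
  by rewrite -ge0_fin_numE// hausdorff_measure_ge0.
rewrite leeBrDr// addeC -leeBrDr//; apply: ge_ereal_sup => _ [u u0 <-].
by rewrite leeBrDr// addeC; exact: key.
Qed.

End hausdorff_measure.

Section borel.
Context {R : realType} {d : nat}.
Local Open Scope ereal_scope.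
Variable s : R.
Notation V := 'rV[R]_d.
Let mu : {outer_measure set V -> \bar R} := hausdorff_measure s.

Section open_caratheodory.
Variable U : set V.
Hypothesis oU : open U.

Let r n : R := (n.+1%:R)^-1%R.
Let W n : set V := [set x | forall y, (`|x - y| < r n)%R -> U y].

Let WU n : W n `<=` U.
Proof. by move=> x; apply; rewrite subrr normr0 /r invr_gt0. Qed.

Let r_lt n : (r n.+1 < r n)%R.
Proof. by rewrite /r ltf_pV2 ?posrE// ltr_nat. Qed.

Let W_S n : W n `<=` W n.+1.
Proof. by move=> x Wx y xy; apply: Wx; exact: lt_trans xy (r_lt _). Qed.

Let W_le n m : (n <= m)%N -> W n `<=` W m.
Proof.
move=> /subnK <-; elim: (m - n)%N => [//|k IH]; rewrite addSn.
exact: subset_trans IH (@W_S _).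
Qed.

Let bigcupW : \bigcup_n W n = U.
Proof.
apply/seteqP; split=> [x [n _]|x Ux]; first exact: WU.
have /nbhs_ballP[e /= e0 eU] := open_nbhs_nbhs (conj oU Ux).
have [n ne] : exists n, (r n < e)%R.
  exists (Num.truncn e^-1); rewrite /r invf_plt ?posrE//.
  exact: truncnS_gt.
exists n => // y xy; apply: eU.
by rewrite -ball_normE /ball_ /=; exact: lt_trans ne.
Qed.

(* points of [W n] and of the complement of [W n.+1] are far apart *)
Let sep n x y : W n x -> ~ W n.+1 y -> (r n - r n.+1 <= `|x - y|)%R.
Proof.
move=> Wx /existsNP[z /not_implyP[yz Uz]]; rewrite leNgt; apply/negP => xy.
apply: Uz; apply: Wx.
rewrite -(subrKA y) (le_lt_trans (ler_normD _ _))//.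
by rewrite -(subrK (r n.+1) (r n)) ltrD.
Qed.

Let sep_gt0 n : (0 < r n - r n.+1)%R.
Proof. by rewrite subr_gt0. Qed.

Lemma open_hausdorff_caratheodory : mu.-caratheodory U.
Proof.
apply: le_caratheodory_measurable => X.
have [->|Xoo] := eqVneq (mu X) +oo; first exact: leey.
have Xf : mu X \is a fin_num by rewrite ge0_fin_numE ?outer_measure_ge0 ?ltey.
pose A n := X `&` W n.
pose D n := A n.+1 `\` A n.
have DX n : D n `<=` X by move=> x [[]].
(* the even (odd) rings are mutually separated *)
have Dsum b N : \sum_(k < N) mu (D (k.*2 + b)%N) <=
    mu (\big[setU/set0]_(k < N) D (k.*2 + b)%N).
  elim: N => [|N IH]; first by rewrite !big_ord0 outer_measure0.
  rewrite !big_ord_recr/=; apply: (le_trans (leeD IH (lexx _))).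
  case: N {IH} => [|N].
    by rewrite !big_ord0 outer_measure0 add0e set0U.
  apply: (@hausdorff_measure_metric _ _ s _ _ _ (sep_gt0 (N.*2 + b).+1)) => x y.
  rewrite -(bigcup_mkord N.+1 (fun k => D (k.*2 + b)%N)) => -[k /= kN [[Xx Wx] _]] [[Xy _] Wy].
  apply: sep.
    apply: W_le Wx; rewrite ltnS leq_add2r leq_double.
    by rewrite -ltnS.
  by move=> Wy'; apply: Wy; split=> //; rewrite doubleS !addSn.
have Dle b N : \sum_(k < N) mu (D (k.*2 + b)%N) <= mu X.
  apply: (le_trans (Dsum b N)); apply: le_outer_measure.
  by rewrite -(bigcup_mkord N (fun k => D (k.*2 + b)%N)) => x [k _ /DX].
have Dfin : \sum_(k <oo) mu (D k) < +oo.
  apply: (@le_lt_trans _ _ (mu X + mu X)).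
    apply: lime_le; first by apply: is_cvg_nneseries => *; exact: outer_measure_ge0.
    apply: nearW => N.
    apply: (@le_trans _ _ (\sum_(0 <= k < N.*2) mu (D k))).
      by apply: lee_sum_nneg_natr => //; rewrite -addnn leq_addr.
    rewrite (_ : \sum_(0 <= k < N.*2) _ =
      \sum_(k < N) mu (D (k.*2 + 0)%N) + \sum_(k < N) mu (D (k.*2 + 1)%N)).
      by apply: leeD; exact: Dle.
    elim: N => [|N IH]; first by rewrite !big_ord0 double0 big_geq// adde0.
    by rewrite doubleS !big_nat_recr//= IH !big_ord_recr/= addn0 addn1 addeACA addeA.
  by rewrite lte_add_pinfty// ltey.
have step n : mu (X `&` U) + mu (X `&` ~` U) <=
    mu X + \sum_(n <= k <oo) mu (D k).
  have XU : X `&` U `<=` A n `|` \bigcup_(k in ~` `I_n) D k.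
    move=> x [Xx]; rewrite -bigcupW => -[m _ Wm].
    have [Wn|Wn] := pselect (W n x); first by left.
    right; have : exists k, `[< W k x >] by exists m; exact/asboolP.
    move=> /ex_minnP[[|k] /asboolP Wk kmin].
      by exfalso; apply: Wn; exact: W_le Wk.
    exists k; last first.
      split; first by split.
      by move=> [_ Wk']; have := kmin k (asboolT Wk'); rewrite ltnn.
    move=> /= kn; apply: Wn; apply: W_le Wk => //.
  have H1 : mu (X `&` U) <= mu (A n) + \sum_(n <= k <oo) mu (D k).
    apply: (le_trans (le_outer_measure mu _ _ XU)).
    apply: (le_trans (outer_measureU2 mu _ _)).
    by apply: leeD => //; exact: outer_measure_sigma_subadditive_tail.
  apply: (le_trans (leeD H1 (lexx _))); rewrite addeAC; apply: leeD => //.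
  apply: (@le_trans _ _ (mu (A n `|` X `&` ~` U))).
    apply: (@hausdorff_measure_metric _ _ s _ _ _ (sep_gt0 n)) => x y.
    by move=> [Xx Wx] [Xy Uy]; apply: sep => // /WU.
  by apply: le_outer_measure => x [[]|[]].
have cvgt : mu X + \sum_(n <= k <oo) mu (D k) @[n --> \oo] --> mu X.
  rewrite -[X in _ --> X]adde0; apply: cvgeD; [|exact: cvg_cst|].
    by rewrite fin_num_adde_defr.
  by apply: nneseries_tail_cvg => // k _; exact: outer_measure_ge0.
rewrite -(cvg_lim _ cvgt)//; apply: lime_ge; first by apply/cvg_ex; exists (mu X).
exact: nearW.
Qed.

End open_caratheodory.

Lemma borel_hausdorff_caratheodory :
  <<s @open V >> `<=` mu.-caratheodory.
Proof.
apply: (@smallest_sub _ (sigma_algebra setT)).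
  split.
  - exact: caratheodory_measurable_set0.
  - by move=> A mA; rewrite setTD; exact: caratheodory_measurable_setC.
  - by move=> F mF; exact: caratheodory_measurable_bigcup.
exact: open_hausdorff_caratheodory.
Qed.

End borel.

Notation borel_rV R d := (g_sigma_algebraType (@open 'rV[R]_d)).

Section hausdorff_restr.
Context {R : realType} {d : nat}.
Local Open Scope ereal_scope.
Implicit Types (s : R) (K : set 'rV[R]_d).

Definition hausdorff_restr s K (A : set (borel_rV R d)) : \bar R :=
  hausdorff_measure s (A `&` K).

Let restr0 s K : hausdorff_restr s K set0 = 0.
Proof. by rewrite /hausdorff_restr set0I hausdorff_measure0. Qed.

Let restr_ge0 s K A : 0 <= hausdorff_restr s K A.
Proof. exact: hausdorff_measure_ge0. Qed.

Let restr_sigma_additive s K : semi_sigma_additive (hausdorff_restr s K).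
Proof.
pose mu : {outer_measure set 'rV[R]_d -> \bar R} := hausdorff_measure s.
move=> F mF tF _; pose E : (set 'rV[R]_d)^nat := F.
have cE n : mu.-caratheodory (E n).
  exact: (@borel_hausdorff_caratheodory R d s _ (mF n)).
have EK : mu (\bigcup_k E k `&` K) = \sum_(k <oo) mu (E k `&` K).
  apply/eqP; rewrite eq_le; apply/andP; split.
    by rewrite setI_bigcupl; exact: outer_measure_sigma_subadditive.
  have := caratheodory_lime_le cE tF (\bigcup_k E k `&` K).
  rewrite (_ : \bigcup_k E k `&` K `&` ~` (\bigcup_k E k) = set0); last first.
    by rewrite setIAC setICr set0I.
  rewrite outer_measure0 adde0; apply: le_trans.
  apply: lee_nneseries => k _; first by move=> _; exact: outer_measure_ge0.
  apply: le_outer_measure => x [Ex Kx]; split=> //; split=> //.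
  by exists k.
rewrite [X in _ --> X]EK.
by apply: is_cvg_nneseries => n _ _; exact: (outer_measure_ge0 mu).
Qed.

HB.instance Definition _ s K := isMeasure.Build _ _ _ (hausdorff_restr s K)
  (restr0 s K) (restr_ge0 s K) (@restr_sigma_additive s K).

End hausdorff_restr.

Section ahlfors_david.
Context {R : realType} {d : nat}.
Local Open Scope ereal_scope.

Definition msupport (mu : {measure set (borel_rV R d) -> \bar R}) :
    set 'rV[R]_d :=
  [set x | forall U : set 'rV[R]_d, open U -> U x -> 0 < mu U].

Definition AD_regular_measure (s C : R)
    (mu : {measure set (borel_rV R d) -> \bar R}) : Prop :=
  forall (x : 'rV[R]_d) (r : R), msupport mu x ->
    (0 < r)%R -> r%:E <= ediam (msupport mu) ->
    (r `^ s / C)%:E <= mu (ecball x r) <= (C * r `^ s)%:E.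

Definition AD_regular_set_const (s C : R) (K : set 'rV[R]_d) : Prop :=
  [/\ (hausdorff_measure s).-caratheodory K,
      0 < hausdorff_measure s K < +oo &
      AD_regular_measure s C (hausdorff_restr s K)].

Definition AD_regular_set (s : R) (K : set 'rV[R]_d) : Prop :=
  exists2 C : R, (1 <= C)%R & AD_regular_set_const s C K.

End ahlfors_david.

(* On [R] the library balls are the usual open intervals.  On ['rV[R]_d] they
   are cubes; this changes covering numbers by bounded factors only, hence not
   the dimension. *)
Section box_dimension.
Context {R : realType} {M : pseudoMetricType R}.

Definition ball_cover (B : set M) (delta : R) (n : nat) : Prop :=
  exists c : 'I_n -> M, B `<=` \bigcup_i ball (c i) delta.

(* the least [n] with [ball_cover B delta n]; the default value 0 is taken
   only if no such [n] exists, e.g. for unbounded [B] *)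
Definition covering_number (B : set M) (delta : R) : nat :=
  xget 0%N [set n | ball_cover B delta n /\
                    forall m, ball_cover B delta m -> (n <= m)%N].

Definition upper_box_dim (B : set M) : \bar R :=
  limf_esup (fun delta : R =>
    (ln (covering_number B delta)%:R / - ln delta)%:E) (0 : R)^'+.

End box_dimension.

(* [K . (K - x0)] *)
Definition dot_diff_set {R : realType} {d : nat} (K : set 'rV[R]_d)
    (x0 : 'rV[R]_d) : set R :=
  [set dotr p.1 (p.2 - x0) | p in K `*` K].

(* Main.v *)
Require Import Defs.
From mathcomp Require Import all_boot all_order all_algebra.
From mathcomp Require Import all_classical all_reals all_analysis.
From mathcomp Require Import ring lra zify.
Import Order.TTheory GRing.Theory Num.Theory.
Import numFieldNormedType.Exports.
Local Open Scope classical_set_scope.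
Local Open Scope ring_scope.

(** The set is bounded in R, so its dimension is at most 1; only the lower bound
    has content.  If x2 - x0 = lam (1, a), then x1 . (x2 - x0) = lam (x + a y) for
    x1 = (x, y), so K . (K - x0) contains a scaled copy of the projection
    pi_a(K), where pi_a(x, y) = x + a y, for every slope a of a direction from
    x0 to another point of K.  There are two cases.

    Some x0 in K sees K in a set of directions that is dense among the slopes in
    [0, 1].  Fix m and pick one such slope a_j in each interval
    (j / 2^m, (j + 1) / 2^m).  Sample K by a maximal 2^-(t m)-separated subset
    of the support of H^s on K, with the uniform probability.  Entropy is
    superadditive along scales: the projection by pi_a has entropy at least the
    sum, over t levels, of the average entropy of the projections of the pieces
    of diameter about 2^-(k m), each seen at the resolution 2^-((k + 1) m), up to
    a bounded loss at each level ([entropy_step]).  A piece seen at a resolution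
    only 2^m times finer does not distinguish slopes closer than 2^-m, so the
    average over j replaces the average over all slopes of Marstrand's theorem:
    since s >= 1, an energy estimate ([energy_bound]) makes this average at least
    m ln 2 - O(ln m) at each level.  Hence for some j the projection by pi_(a_j)
    meets at least 2^(t m (1 - o(1))) intervals of length 2^-(t m)
    ([entropy_bound]), where o(1) tends to 0 as m grows.  The 2^m points
    x2 do not depend on t, so the factors lam are harmless ([dense_directions_cover]).

    Otherwise every x0 in K misses an interval of slopes from a countable list,
    and H^s(K) > 0 provides one interval (p, q) missed from all points of a
    subset E of K with H^s(E) > 0.  The cone condition makes E a Lipschitz graph
    over a line, by a linear functional tau.  As s >= 1, tau(E) cannot be covered by
    intervals of small total length, and thus fills almost all of some interval
    [a, b] ([thick_interval]).  Choose x0, x2 in E above the ends of [a, b], and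
    let u be the inner product with x2 - x0.  It increases by |x2 - x0|^2 from
    x0 to x2, while being Lipschitz in tau, so the few gaps of tau(E) cannot
    account for this increase: at scale d the set u(E) needs at least c / d
    intervals ([graph_piece_cover]). *)

Set Implicit Arguments.
Unset Strict Implicit.
Unset Printing Implicit Defensive.

(** * Entropy of functions on a finite set *)

Lemma ln_le_subr1 (R : realType) (y : R) : 0 < y -> ln y <= y - 1.
Proof.
move=> y0; have -> : y = 1 + (y - 1) by lra.
rewrite [leRHS](_ : _ = y - 1); last by lra.
apply: le_ln1Dx; lra.
Qed.

(** Jensen's inequality for ln, with the average bounded by V. *)
Lemma sum_ln_le (R : realType) (I : finType) (x : I -> R) (V : R) :
  (0 < #|I|)%N -> (forall i, 0 < x i) -> \sum_i x i <= V * #|I|%:R ->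
  \sum_i ln (x i) <= #|I|%:R * ln V.
Proof.
move=> I0 x0 xV.
have N0 : (0 : R) < #|I|%:R by rewrite ltr0n.
have V0 : 0 < V.
  rewrite -(pmulr_lgt0 _ N0); apply: lt_le_trans xV.
  have /card_gt0P[i _] := I0.
  rewrite (bigD1 i)//= ltr_pwDl//; apply: sumr_ge0 => j _; exact: ltW.
apply: (@le_trans _ _ (\sum_i (ln V + (x i / V - 1)))).
  apply: ler_sum => i _; have := @ln_le_subr1 R _ (divr_gt0 (x0 i) V0).
  rewrite ln_div ?posrE//; lra.
rewrite big_split/= sumr_const mulr_natl gerDl sumrB sumr_const -mulr_suml subr_le0.
by rewrite ler_pdivrMr// mulrC.
Qed.

Definition fiber_size (T : finType) (A : eqType) (f : T -> A) (p : T) : nat :=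
  #|[pred q | f q == f p]|.

Section Fibers.
Context {R : realType} {T : finType}.
Implicit Types (A B C : eqType).

Lemma fiber_size_gt0 A (f : T -> A) p : (0 < fiber_size f p)%N.
Proof. by apply/card_gt0P; exists p; rewrite inE. Qed.

Lemma fiber_size_gt0r A (f : T -> A) p : (0 : R) < (fiber_size f p)%:R.
Proof. by rewrite ltr0n fiber_size_gt0. Qed.

Lemma fiber_sizeE A (f : T -> A) p : (fiber_size f p)%:R = \sum_(q | f q == f p) (1 : R).
Proof. by rewrite /fiber_size -sum1_card natr_sum; apply: eq_bigl => q; rewrite inE. Qed.

Lemma eq_fiber_size A (f : T -> A) p q : f p = f q -> fiber_size f p = fiber_size f q.
Proof. by move=> pq; rewrite /fiber_size pq. Qed.

(** Each fiber of f contributes at most 1 to the sum, and g separates the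
    fibers that meet D. *)
Lemma sum_inv_fiber_size_le A (f : T -> A) (D : pred T) (G : finType) (g : T -> G) :
  (forall p q, D p -> D q -> g p = g q -> f p = f q) ->
  \sum_(p | D p) (fiber_size f p)%:R^-1 <= #|G|%:R :> R.
Proof.
move=> gf; rewrite (partition_big g xpredT)//=.
rewrite -[leRHS]/(#|G|%:R) -sum1_card natr_sum; apply: ler_sum => i _.
have [p /andP[Dp /eqP gp]|no] := pickP (fun p => D p && (g p == i)); last first.
  by rewrite big_pred0// => p; exact: no.
rewrite (eq_bigr (fun=> (fiber_size f p)%:R^-1 : R)); last first.
  by move=> q /andP[Dq /eqP gq]; rewrite (@eq_fiber_size _ f q p)//; apply: gf => //; rewrite gq.
rewrite sumr_const -[leLHS]mulr_natl ler_pdivrMr ?fiber_size_gt0r// mul1r ler_nat.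
apply: subset_leq_card; apply/fintype.subsetP => q; rewrite !inE => /andP[Dq /eqP gq].
by apply/eqP; apply: gf => //; rewrite gq.
Qed.

(** If p is uniform on T, with N = #|T|, the Shannon entropy of f(p) is
    ln N - sum_ln_fiber f / N. *)
Definition sum_ln_fiber A (f : T -> A) : R := \sum_p ln (fiber_size f p)%:R.

(** The entropy is at most ln W when f has W values; the sum of the inverse
    fiber sizes is the number of values. *)
Lemma sum_ln_fiber_ge A (f : T -> A) (W : R) : (0 < #|T|)%N ->
  \sum_p (fiber_size f p)%:R^-1 <= W ->
  #|T|%:R * (ln #|T|%:R - ln W) <= sum_ln_fiber f.
Proof.
move=> T0 fW; have N0 : (0 : R) < #|T|%:R by rewrite ltr0n.
have W0 : 0 < W.
  apply: lt_le_trans fW; have /card_gt0P[i _] := T0.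
  rewrite (bigD1 i)//= ltr_pwDl ?invr_gt0 ?fiber_size_gt0r//.
  by apply: sumr_ge0 => j _; rewrite invr_ge0.
have x0 p : 0 < ((fiber_size f p)%:R^-1 : R) by rewrite invr_gt0 fiber_size_gt0r.
have := @sum_ln_le R T _ (W / #|T|%:R) T0 x0.
rewrite ln_div ?posrE// divfK ?gt_eqF// => /(_ fW).
rewrite (eq_bigr (fun p => - ln (fiber_size f p)%:R)); last first.
  by move=> p _; rewrite lnV// posrE fiber_size_gt0r.
rewrite sumrN /sum_ln_fiber; lra.
Qed.

Lemma sum_ln_fiber_le A (f : T -> A) : sum_ln_fiber f <= #|T|%:R * ln #|T|%:R.
Proof.
rewrite /sum_ln_fiber mulr_natl -sumr_const; apply: ler_sum => p _.
rewrite ler_ln ?posrE ?fiber_size_gt0r ?ler_nat ?max_card//.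
by rewrite ltr0n; apply/card_gt0P; exists p.
Qed.

(** Conditioning on Q decreases the conditional entropy of f given g. By Jensen
    it suffices that the ratios x p below have average at most 1; expanding the
    two fiber sizes in the numerator as numbers of points q and r, and summing
    over p first, gives at most one unit for each q. *)
Lemma sum_ln_fiber_submod A B C (f : T -> A) (g : T -> B) (Q : T -> C) :
  (0 < #|T|)%N -> (forall p q, f p = f q -> g p = g q) ->
  sum_ln_fiber (fun p => (g p, Q p)) - sum_ln_fiber (fun p => (f p, Q p)) <=
  sum_ln_fiber g - sum_ln_fiber f.
Proof.
move=> T0 fg; set gQ := (fun p => (g p, Q p)); set fQ := (fun p => (f p, Q p)).
pose x p : R := (fiber_size f p)%:R * (fiber_size gQ p)%:R / ((fiber_size g p)%:R * (fiber_size fQ p)%:R).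
have x0 p : 0 < x p by rewrite divr_gt0// mulr_gt0// fiber_size_gt0r.
suff xV : \sum_p x p <= 1 * #|T|%:R.
  have := sum_ln_le T0 x0 xV; rewrite ln1 mulr0.
  rewrite (eq_bigr (fun p => (ln (fiber_size f p)%:R + ln (fiber_size gQ p)%:R) -
     (ln (fiber_size g p)%:R + ln (fiber_size fQ p)%:R))); last first.
    move=> p _; rewrite /x ln_div ?posrE ?mulr_gt0 ?fiber_size_gt0r//.
    by rewrite !lnM ?posrE ?fiber_size_gt0r.
  by rewrite sumrB !big_split/= -!/(sum_ln_fiber _); lra.
have -> : \sum_p x p = \sum_q \sum_(r | g r == g q)
    \sum_(p | (f q == f p) && (gQ r == gQ p)) ((fiber_size g q)%:R * (fiber_size fQ p)%:R)^-1.
  under [RHS]eq_bigr do rewrite (exchange_big_dep predT)//=.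
  rewrite [RHS]exchange_big/=; apply: eq_bigr => p _.
  rewrite /x !fiber_sizeE mulr_suml mulr_suml big_mkcond; apply: eq_bigr => q _.
  case: eqP => [fqp|fqp]; last by rewrite big_pred0 // => r; rewrite andbF.
  rewrite mul1r mulr_suml; apply: eq_big => [r|r _].
    rewrite andTb andbC; case: eqP => //= -[grp _].
    by rewrite grp (fg _ _ fqp) eqxx.
  by rewrite mul1r -!fiber_sizeE (eq_fiber_size (fg _ _ fqp)).
rewrite mul1r -sumr_const; apply: ler_sum => q _.
apply: (@le_trans _ _ (\sum_(r | g r == g q) (fiber_size g q)%:R^-1)); last first.
  by rewrite sumr_const -[leLHS]mulr_natl ler_pdivrMr ?fiber_size_gt0r// mul1r.
apply: ler_sum => r _; under eq_bigr do rewrite invfM.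
rewrite -mulr_sumr ler_piMr ?invr_ge0//.
rewrite [leRHS](_ : _ = #|{: unit}|%:R); last by rewrite card_unit.
apply: (@sum_inv_fiber_size_le _ fQ _ _ (fun=> tt)).
move=> p p' /andP[/eqP fp /eqP[_ Qp]] /andP[/eqP fp' /eqP[_ Qp']] _.
by rewrite /fQ -fp -fp' -Qp -Qp'.
Qed.

(** The conditional entropy of f given Q is at most ln c when f has at most c
    values on each fiber of Q. *)
Lemma sum_ln_fiber_pair_le A B (f : T -> A) (Q : T -> B) (c : nat) :
  (0 < #|T|)%N ->
  (forall q, exists g : T -> 'I_c, forall p p', Q p = Q q -> Q p' = Q q ->
     g p = g p' -> f p = f p') ->
  sum_ln_fiber Q - sum_ln_fiber (fun p => (f p, Q p)) <= #|T|%:R * ln c%:R.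
Proof.
move=> T0 H; set fQ := (fun p => (f p, Q p)).
pose x p : R := (fiber_size Q p)%:R / (fiber_size fQ p)%:R.
have x0 p : 0 < x p by rewrite divr_gt0// fiber_size_gt0r.
have : \sum_p x p <= c%:R * #|T|%:R.
  have -> : \sum_p x p = \sum_q \sum_(p | Q q == Q p) (fiber_size fQ p)%:R^-1.
    rewrite (exchange_big_dep predT)//=; apply: eq_bigr => p _.
    by rewrite /x fiber_sizeE mulr_suml; apply: eq_bigr => q _; rewrite mul1r.
  rewrite mulr_natr -sumr_const; apply: ler_sum => q _.
  have [g gP] := H q; rewrite [leRHS](_ : _ = #|'I_c|%:R); last by rewrite card_ord.
  apply: (@sum_inv_fiber_size_le _ fQ _ _ g) => p p' /eqP Qp /eqP Qp' gpp'.
  by congr pair; [exact: gP|rewrite -Qp].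
move=> /(sum_ln_le T0 x0); rewrite (eq_bigr (fun p => ln (fiber_size Q p)%:R - ln (fiber_size fQ p)%:R)).
  by rewrite sumrB.
by move=> p _; rewrite ln_div ?posrE ?fiber_size_gt0r.
Qed.

End Fibers.

(** * The plane and Hausdorff measure *)

Section Plane.
Context {R : realType}.
Implicit Types (u v x y : 'rV[R]_2).

Definition cx u : R := u ord0 ord0.
Definition cy u : R := u ord0 ord_max.

Lemma dotrE u v : dotr u v = cx u * cx v + cy u * cy v.
Proof.
rewrite /dotr !big_ord_recl big_ord0 addr0 /cx /cy.
by rewrite (_ : lift ord0 ord0 = ord_max)//; apply/val_inj.
Qed.

Lemma cxB u v : cx (u - v) = cx u - cx v. Proof. by rewrite /cx !mxE. Qed.
Lemma cyB u v : cy (u - v) = cy u - cy v. Proof. by rewrite /cy !mxE. Qed.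

Lemma rV2P u v : cx u = cx v -> cy u = cy v -> u = v.
Proof.
move=> ex ey; apply/rowP => i; have [->|->] : i = ord0 \/ i = ord_max by
  case: i => -[|[|//]] ?; [left|right]; apply/val_inj.
- exact: ex.
- exact: ey.
Qed.

Lemma enorm_ge0 u : 0 <= enorm u. Proof. exact: sqrtr_ge0. Qed.

Lemma enorm_sqr u : enorm u ^+ 2 = cx u ^+ 2 + cy u ^+ 2.
Proof. by rewrite /enorm dotrE sqr_sqrtr// addr_ge0// -expr2 sqr_ge0. Qed.

Lemma cx_le_enorm u : `|cx u| <= enorm u.
Proof.
rewrite -(@ler_pXn2r _ 2)// ?nnegrE ?enorm_ge0// enorm_sqr real_normK ?num_real//.
by rewrite lerDl sqr_ge0.
Qed.

Lemma cy_le_enorm u : `|cy u| <= enorm u.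
Proof.
rewrite -(@ler_pXn2r _ 2)// ?nnegrE ?enorm_ge0// enorm_sqr real_normK ?num_real//.
by rewrite lerDr sqr_ge0.
Qed.

Lemma enorm_le_sum u : enorm u <= `|cx u| + `|cy u|.
Proof.
rewrite -(@ler_pXn2r _ 2)// ?nnegrE ?enorm_ge0 ?addr_ge0// enorm_sqr sqrrD.
rewrite !real_normK ?num_real// -addrA lerD2l lerDr.
by rewrite mulrn_wge0// mulr_ge0.
Qed.

Lemma enorm_gt0 u : u != 0 -> 0 < enorm u.
Proof.
move=> u0; rewrite lt_def enorm_ge0 andbT; apply: contraNneq u0 => e0.
have := enorm_sqr u; rewrite e0 expr0n/= => /esym/eqP.
rewrite paddr_eq0 ?sqr_ge0// !sqrf_eq0 => /andP[/eqP h1 /eqP h2].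
by apply/eqP/rV2P; rewrite ?h1 ?h2 /cx /cy mxE.
Qed.

Lemma dotr_le_enorm u v : `|dotr u v| <= enorm u * enorm v.
Proof.
rewrite -(@ler_pXn2r _ 2)// ?nnegrE ?mulr_ge0 ?enorm_ge0//.
rewrite real_normK ?num_real// exprMn !enorm_sqr dotrE.
have := sqr_ge0 (cx u * cy v - cy u * cx v); nra.
Qed.

Lemma continuous_cx : continuous cx.
Proof. exact: coord_continuous. Qed.

Lemma continuous_cy : continuous cy.
Proof. exact: coord_continuous. Qed.

Lemma closed_ecball x (r : R) : closed (ecball x r).
Proof.
have [r0|r0] := ltP r 0.
  rewrite (_ : ecball x r = set0); first exact: closed0.
  apply/seteqP; split => y //=; rewrite /ecball/= => h.
  by have := lt_le_trans r0 (enorm_ge0 (y - x)); rewrite ltNge h.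
rewrite (_ : ecball x r =
    (fun y => (cx y - cx x) * (cx y - cx x) + (cy y - cy x) * (cy y - cy x)) @^-1` [set z | z <= r ^+ 2]).
  apply: closed_comp; last exact: closed_le.
  have h (f : 'rV[R]_2 -> R) : continuous f ->
      continuous (fun y => (f y - f x) * (f y - f x)).
    move=> cf y; have fy : f z - f x @[z --> y] --> f y - f x.
      by apply: (cvgB (cf y)); exact: cvg_cst.
    exact: (cvgM fy fy).
  move=> y _; exact: (cvgD (h _ continuous_cx y) (h _ continuous_cy y)).
apply/seteqP; split => y; rewrite /ecball/= -cxB -cyB -!expr2 -enorm_sqr;
  by rewrite ler_pXn2r// ?nnegrE ?enorm_ge0.
Qed.

Lemma measurable_ecball x (r : R) :
  measurable (ecball x r : set (borel_rV R 2)).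
Proof.
rewrite -[X in measurable X]setCK; apply: measurableC.
have oC : open (~` ecball x r) by apply: closed_openC; exact: closed_ecball.
have H : <<s @open 'rV[R]_2 >> (~` ecball x r) by exact: sub_sigma_algebra.
exact: H.
Qed.

Lemma ball_coordP x y (e : R) : 0 < e ->
  ball x e y <-> `|cx x - cx y| < e /\ `|cy x - cy y| < e.
Proof.
move=> e0; split=> [[_ h]|[h1 h2]].
  by split; have := h ord0; [move=> /(_ ord0)|move=> /(_ ord_max)].
split => // i j; rewrite (ord1 i); have [->|->] : j = ord0 \/ j = ord_max by
  case: j => -[|[|//]] ?; [left|right]; apply/val_inj.
- exact: h1.
- exact: h2.
Qed.

Definition close x y (r : R) := (`|cx x - cx y| <= r) && (`|cy x - cy y| <= r).

Lemma close_sym x y r : close x y r = close y x r.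
Proof. by rewrite /close (distrC (cx x)) (distrC (cy x)). Qed.

Lemma close_trans y x z r1 r2 : close x y r1 -> close y z r2 -> close x z (r1 + r2).
Proof.
move=> /andP[h1 h2] /andP[h3 h4]; apply/andP; split.
  by apply: le_trans (ler_distD (cx y) _ _) _; rewrite lerD.
by apply: le_trans (ler_distD (cy y) _ _) _; rewrite lerD.
Qed.

Lemma ecball_close x y r : ecball x r y -> close x y r.
Proof.
move=> xy; rewrite close_sym /close -cxB -cyB.
by rewrite (le_trans (cx_le_enorm _) xy) (le_trans (cy_le_enorm _) xy).
Qed.

Lemma close_ecball x y r : close x y r -> ecball x (2 * r) y.
Proof.
rewrite close_sym /close -cxB -cyB => /andP[h1 h2].
by apply: (le_trans (enorm_le_sum _)); lra.
Qed.

(** A finite sample, at scale 2^-n, of a set of regularity exponent s when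
    B = 2^s: balls contain at most, and the whole sample at least, the expected
    number of points up to the factor C, and at each scale the sample splits into
    few small pieces, the fibers of Q. *)
Definition regular_sample (B C : R) n N (f : 'I_N -> 'rV[R]_2) :=
  [/\ forall p l, (l <= n)%N ->
        #|[pred q | close (f p) (f q) (2 / 2 ^+ l)]|%:R <= C * B ^+ (n - l),
      B ^+ n <= C * N%:R &
      forall l, exists M (Q : 'I_N -> 'I_M), M%:R <= C * B ^+ l /\
        forall p q, Q p = Q q -> close (f p) (f q) (2 / 2 ^+ l)].

Local Open Scope ereal_scope.

Lemma hausdorff_cover0 (s : R) (F : (set 'rV[R]_2)^nat) A :
  (forall n, hausdorff_measure s (F n) = 0) -> A `<=` \bigcup_n F n ->
  hausdorff_measure s A = 0.
Proof.
move=> F0 AF; apply/eqP; rewrite eq_le hausdorff_measure_ge0 andbT.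
apply: (le_trans (le_hausdorff_measure s AF)).
apply: (le_trans (hausdorff_measure_sigma_subadditive s F)).
by rewrite eseries0.
Qed.

(** One parameter bounds both the diameters and the sum: a vanishing measure
    has to be tested only against covers that are fine and cheap at once. *)
Lemma hausdorff_measure0_of_covers (s : R) A :
  (forall e : R, (0 < e)%R -> exists U : (set 'rV[R]_2)^nat,
    [/\ A `<=` \bigcup_i U i, forall i, ediam (U i) <= e%:E &
       \sum_(i <oo) diam_pow s (U i) <= e%:E]) ->
  hausdorff_measure s A = 0.
Proof.
move=> H; apply/eqP; rewrite eq_le hausdorff_measure_ge0 andbT.
apply: ge_ereal_sup => _ [t t0 <-]; apply/lee_addgt0Pr => e e0; rewrite add0e.
have [|U [AU Ud Us]] := H (Num.min e t); first by rewrite lt_min e0.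
apply: (@le_trans _ _ (\sum_(i <oo) diam_pow s (U i))).
  apply: ereal_inf_lbound; exists U => //; split => // i.
  by apply: (le_trans (Ud i)); rewrite lee_fin ge_min lexx orbT.
by apply: (le_trans Us); rewrite lee_fin ge_min lexx.
Qed.

Lemma ediam1 x : ediam [set x] = 0.
Proof.
rewrite /ediam (_ : [set _ | _ in _] = [set 0]) ?ereal_sup1//.
apply/seteqP; split => [_ [[a b] [/= -> ->] <-]|_ ->] /=.
  by rewrite subrr /enorm dotrE /cx /cy !mxE !mulr0 addr0 sqrtr0.
by exists (x, x) => //=; rewrite subrr /enorm dotrE /cx /cy !mxE !mulr0 addr0 sqrtr0.
Qed.

Lemma hausdorff_measure1 (s : R) x : (0 < s)%R -> hausdorff_measure s [set x] = 0.
Proof.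
move=> s0; apply: hausdorff_measure0_of_covers => e e0.
exists (fun=> [set x]); split; first by move=> y ->; exists 0%N.
  by move=> i; rewrite ediam1 lee_fin ltW.
rewrite eseries0 ?lee_fin ?ltW// => i _ _; rewrite /diam_pow ediam1.
by case: ifP => // _; rewrite poweR0r// gt_eqF.
Qed.

End Plane.

(** * Entropy of the projections of a regular sample *)

Lemma card_ord_close (M D : nat) (J : {pred 'I_M}) :
  (forall j j', j \in J -> j' \in J -> (j <= j' + D)%N) -> (#|J| <= D.+1)%N.
Proof.
move=> H; have [j0 j0J|J0] := pickP (mem J); last by rewrite eq_card0.
case: (@arg_minnP _ j0 (mem J) (@nat_of_ord M) j0J) => i iJ imin.
pose g (j : 'I_M) : 'I_D.+1 := inord (j - i).
rewrite -[leqRHS]card_ord -(@card_in_image _ _ g J) ?max_card// => j j' jJ j'J.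
have ij := imin j jJ; have ij' := imin j' j'J.
have jD := H j i jJ iJ; have j'D := H j' i j'J iJ.
move/(congr1 val); rewrite /= !inordK; [|lia..].
by move=> e; apply/val_inj => /=; lia.
Qed.

Lemma slope01 (R : realType) (m : nat) (j : 'I_(2 ^ m)) (a : R) :
  j%:R < 2 ^+ m * a < j.+1%:R -> 0 <= a <= 1.
Proof.
have m2 : (0 : R) < 2 ^+ m by rewrite exprn_gt0.
move=> /andP[h1 h2]; apply/andP; split.
  rewrite -(pmulr_rge0 _ m2); apply: ltW; apply: le_lt_trans h1.
  by rewrite ler0n.
rewrite -(ler_pM2l m2) mulr1; apply: (le_trans (ltW h2)).
by rewrite -natrX ler_nat.
Qed.

(** Transversality. The slopes a j are spaced by about 2^-m. A displacement
    (x, y) of size above w 2^(m - i) is projected within w of 0 only for slopes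
    in an interval of length at most 4 * 2^i / 2^m: if y is small compared with
    x, for none; otherwise the projection varies at the rate |y|. *)
Lemma card_slopes (R : realType) (m i : nat) (a : 'I_(2 ^ m) -> R) (x y w : R) :
  (forall j : 'I_(2 ^ m), j%:R < 2 ^+ m * a j < j.+1%:R) ->
  0 < w -> (i <= m)%N ->
  ((i < m)%N -> ~~ ((`|x| <= w * 2 ^+ (m - i)) && (`|y| <= w * 2 ^+ (m - i)))) ->
  (#|[pred j | (`|x + a j * y| < w)%R]| <= 5 * 2 ^ i)%N.
Proof.
move=> aj w0; rewrite leq_eqVlt => /orP[/eqP -> _|im /(_ im)].
  rewrite (leq_trans (max_card _))// card_ord; lia.
set d := w * _ => xy.
have dE : d = w * 2 ^+ m / 2 ^+ i by rewrite /d -mulrA -expfB.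
have i0 : (0 : R) < 2 ^+ i by rewrite exprn_gt0.
have m0 : (0 : R) < 2 ^+ m by rewrite exprn_gt0.
have d2 : 2 * w <= d.
  rewrite mulrC /d ler_pM2l// -[leLHS]expr1; apply: ler_weXn2l; first by lra.
  by rewrite subn_gt0.
have d0 : 0 < d by lra.
have aj1 (j : 'I_(2 ^ m)) : 0 <= a j <= 1 by exact: slope01 (aj j).
have [yd|dy] := lerP `|y| (d / 2).
  rewrite eq_card0// => j; rewrite !inE; apply/negP => h.
  have xd : d < `|x|.
    rewrite ltNge; apply/negP => xd; move/negP: xy; apply.
    by rewrite xd/=; lra.
  have : `|x| <= `|x + a j * y| + `|a j * y|.
    by rewrite -[in leLHS](addrK (a j * y) x) ler_normB.
  have /andP[h1 h2] := aj1 j.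
  rewrite normrM (ger0_norm h1).
  have : a j * `|y| <= `|y| by rewrite ler_piMl.
  lra.
apply: (leq_trans (@card_ord_close _ (4 * 2 ^ i) _ _)); last by lia.
move=> j j'; rewrite !inE => hj hj'.
have y0 : 0 < `|y| by lra.
have h : (a j - a j') * `|y| <= 2 * w.
  have [y1|y1] := ler0P y.
    by move: hj hj'; rewrite !ltr_norml => /andP[? ?] /andP[? ?]; nra.
  by move: hj hj'; rewrite !ltr_norml => /andP[? ?] /andP[? ?]; nra.
have h2 : (a j - a j') * 2 ^+ m < 4 * 2 ^+ i.
  rewrite -(ltr_pM2r y0); apply: (@le_lt_trans _ _ (2 * w * 2 ^+ m)).
    by rewrite mulrAC ler_pM2r.
  have : w * 2 ^+ m = d * 2 ^+ i by rewrite dE divfK// gt_eqF.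
  have : d * 2 ^+ i < 2 * `|y| * 2 ^+ i by rewrite ltr_pM2r//; lra.
  lra.
have /andP[h3 _] := aj j; have /andP[_ h4] := aj j'.
have : (j%:R : R) < (j' + (4 * 2 ^ i).+1)%:R.
  rewrite natrD [X in _ + X](_ : _ = 4 * 2 ^+ i + 1); last first.
    by rewrite -natr1 natrM natrX.
  rewrite -natr1 in h4; lra.
by rewrite ltr_nat addnS ltnS.
Qed.

Lemma floor_refine (R : realType) (L : R) (l : nat) (x y : R) : L = l%:R ->
  0 < L -> Num.floor (L * x) = Num.floor (L * y) -> Num.floor x = Num.floor y.
Proof.
move=> -> L0; wlog xy : x y / x <= y.
  by move=> H; case: (leP x y) => [|/ltW] xy e; [exact: H|symmetry; exact: H].
move=> e; apply/eqP; rewrite eq_le le_floor//=.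
rewrite floor_ge_int; set z := Num.floor y.
have : ((l%:Z * z)%:~R : R) <= l%:R * x.
  rewrite -floor_ge_int e floor_ge_int intrM ler_pM2l//.
  exact: floor_le.
by rewrite intrM ler_pM2l.
Qed.

Lemma floor_offset (R : realType) (x y : R) (k : nat) : `|x - y| <= k%:R ->
  - k%:Z <= Num.floor x - Num.floor y <= k%:Z.
Proof.
have /andP[h1 h2] := floor_itv x; have /andP[h3 h4] := floor_itv y.
rewrite intrD in h2; rewrite intrD in h4.
rewrite ler_norml => /andP[h5 h6]; apply/andP; split.
  rewrite -ltzD1 -(ltr_int R) !(intrD, mulrNz); lra.
rewrite -ltzD1 -(ltr_int R) !(intrD, mulrNz); lra.
Qed.

(** Integers at distance at most k from z are encoded in 2 k + 1 values. *)
Lemma inord_offset_inj (k : nat) (x y z : int) :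
  inord (absz (x - z + k%:Z)) = inord (absz (y - z + k%:Z)) :> 'I_(k + k).+1 ->
  - k%:Z <= x - z <= k%:Z -> - k%:Z <= y - z <= k%:Z -> x = y.
Proof. by move=> /(congr1 val) /= + h1 h2; rewrite !inordK; lia. Qed.

Section ProjectionEntropy.
Context {R : realType} (m t N : nat) (f : 'I_N -> 'rV[R]_2).
Context (a : 'I_(2 ^ m) -> R) (B C : R).

Local Notation T := 'I_N.

Hypothesis aj : forall j : 'I_(2 ^ m), j%:R < 2 ^+ m * a j < j.+1%:R.
Hypothesis B2 : 2 <= B.
Hypothesis C0 : 0 < C.
Hypothesis fP : regular_sample B C (t * m) f.

Definition proj_cell (k : nat) (j : 'I_(2 ^ m)) (p : T) : int :=
  Num.floor (2 ^+ (k * m) * (cx (f p) + a j * cy (f p))).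

Lemma proj_cell_refine k j p q :
  proj_cell k.+1 j p = proj_cell k.+1 j q -> proj_cell k j p = proj_cell k j q.
Proof.
rewrite /proj_cell mulSn exprD -!mulrA.
by apply: (@floor_refine _ _ (2 ^ m)); rewrite ?natrX ?exprn_gt0.
Qed.

Lemma proj_cell_eq k j p q : proj_cell k j p = proj_cell k j q ->
  `|(cx (f p) - cx (f q)) + a j * (cy (f p) - cy (f q))| < (2 ^+ (k * m))^-1.
Proof.
move=> e; rewrite -[ltRHS]mul1r ltr_pdivlMr ?exprn_gt0//.
have k0 : (0 : R) < 2 ^+ (k * m) by rewrite exprn_gt0.
rewrite -[X in _ * X](gtr0_norm k0) -normrM mulrC.
have := floor_itv (2 ^+ (k * m) * (cx (f p) + a j * cy (f p))).
have := floor_itv (2 ^+ (k * m) * (cx (f q) + a j * cy (f q))).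
rewrite -!/(proj_cell _ _ _) e intrD => /andP[h1 h2] /andP[h3 h4].
rewrite ltr_norml; apply/andP; split; lra.
Qed.

(** The collision probability of the projections, given the piece, averaged over
    the slopes. Two points of a piece at distance about 2^-(k m + i) collide for
    a proportion at most 5 * 2^i / 2^m of the slopes ([card_slopes]), and a point
    has at most C B^(t m - k m - i) neighbours at that distance; as 2 <= B, each
    of the m + 1 values of i contributes the same bound. Summing the inverse sizes
    of the pieces counts the pieces, so that small pieces do no harm. *)
Lemma energy_bound (k : nat) (M : nat) (Q : T -> 'I_M) :
  (k < t)%N -> M%:R <= C * B ^+ (k * m) ->
  (forall p q, Q p = Q q -> close (f p) (f q) (2 / 2 ^+ (k * m))) ->
  \sum_j \sum_p (fiber_size (fun q => (proj_cell k.+1 j q, Q q)) p)%:R / (fiber_size Q p)%:R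
    <= 5 * C ^+ 3 * m.+1%:R * #|T|%:R :> R.
Proof.
have [cnt tot _] := fP; move=> kt MC QP.
have B0 : 0 < B by move: B2; lra.
rewrite exchange_big/=.
under eq_bigr do rewrite -mulr_suml.
pose Z := 5 * C * m.+1%:R * B ^+ (t * m - k * m).
apply: (@le_trans _ _ (\sum_p Z * (fiber_size Q p)%:R^-1)); last first.
  rewrite -mulr_sumr; apply: (@le_trans _ _ (Z * (C * B ^+ (k * m)))).
    rewrite ler_pM2l; last by rewrite !mulr_gt0 ?exprn_gt0.
    apply: le_trans MC; rewrite -[X in _ <= X%:R](card_ord M).
    exact: (@sum_inv_fiber_size_le _ _ _ Q predT _ Q).
  rewrite /Z [leLHS](_ : _ = 5 * C ^+ 2 * m.+1%:R * B ^+ (t * m)); last first.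
    rewrite -[in RHS](@subnK (k * m) (t * m)); last by rewrite leq_mul2r (ltnW kt) orbT.
    by rewrite exprD; ring.
  rewrite [leRHS](_ : _ = 5 * C ^+ 2 * m.+1%:R * (C * #|T|%:R)); last by ring.
  by rewrite card_ord ler_pM2l// !mulr_gt0 ?exprn_gt0.
apply: ler_sum => p _; rewrite ler_pM2r ?invr_gt0 ?fiber_size_gt0r//.
pose w : R := (2 ^+ (k.+1 * m))^-1.
have dy i : (i < m)%N -> w * 2 ^+ (m - i) = 2 / 2 ^+ (k * m + i.+1).
  move=> im; rewrite expfB// /w mulSn exprD [in RHS]exprD exprS.
  by field; rewrite !expf_neq0.
(* i is maximal such that p and q are within 2 / 2 ^+ (k * m + i): the sum
   over i is bounded below by its term at this scale. *)
have pt q : (\sum_j (((proj_cell k.+1 j q, Q q) == (proj_cell k.+1 j p, Q p)) : nat) <=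
    \sum_(i < m.+1) 5 * 2 ^ i * close (f p) (f q) (2 / 2 ^+ (k * m + i)))%N.
  have [qp|qp] := eqVneq (Q q) (Q p); last first.
    rewrite big1// => j _; case: eqP => // -[_] e.
    by rewrite e eqxx in qp.
  have nz : exists i : nat, (i <= m)%N && close (f p) (f q) (2 / 2 ^+ (k * m + i)).
    by exists 0; rewrite addn0 QP.
  case: (ex_maxnP nz (fun i => fun H => proj1 (andP H))) => i /andP[im ni] imax.
  apply: (@leq_trans (5 * 2 ^ i)); last first.
    rewrite (bigD1 (Ordinal (im : (i < m.+1)%N)))//= ni muln1.
    exact: leq_addr.
  apply: leq_trans (@card_slopes R m i a (cx (f p) - cx (f q)) (cy (f p) - cy (f q)) w aj _ im _).
  - rewrite -sum1_card [leqRHS]big_mkcond/=; apply: leq_sum => j _; rewrite inE.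
    case: eqP => // -[e _]; rewrite (_ : (`|_| < w) = true)//.
    by apply: proj_cell_eq; rewrite e.
  - by rewrite invr_gt0 exprn_gt0.
  - move=> lim; apply/negP; rewrite dy// => /(conj lim)/andP/imax.
    by rewrite ltnn.
have -> : \sum_j (fiber_size (fun q => (proj_cell k.+1 j q, Q q)) p)%:R =
   (\sum_q \sum_j (((proj_cell k.+1 j q, Q q) == (proj_cell k.+1 j p, Q p)) : nat))%N%:R :> R.
  rewrite exchange_big/= natr_sum; apply: eq_bigr => j _; congr _%:R.
  by rewrite /fiber_size -sum1_card big_mkcond/=; apply: eq_bigr => q _; rewrite inE; case: eqP.
apply: (@le_trans _ _ (\sum_q \sum_(i < m.+1) 5 * 2 ^ i * close (f p) (f q) (2 / 2 ^+ (k * m + i)))%N%:R).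
  by rewrite ler_nat leq_sum.
rewrite exchange_big/= natr_sum.
rewrite [leRHS](_ : _ = \sum_(i < m.+1) 5 * C * B ^+ (t * m - k * m)); last first.
  by rewrite sumr_const card_ord -mulr_natl /Z; ring.
apply: ler_sum => i _; rewrite -big_distrr/= natrM natrM natrX.
have lt1 : (k * m + i <= t * m)%N.
  by rewrite (@leq_trans (k.+1 * m))// ?leq_mul2r ?kt ?orbT// mulSn addnC leq_add2r -ltnS.
rewrite (_ : (\sum_q _)%N = #|[pred q | close (f p) (f q) (2 / 2 ^+ (k * m + i))]|); last first.
  by rewrite -sum1_card [in RHS]big_mkcond/=; apply: eq_bigr => q _; rewrite inE; case: close.
apply: (@le_trans _ _ (5 * B ^+ i * (C * B ^+ (t * m - (k * m + i))))).
  apply: ler_pM => //; last exact: cnt.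
  by rewrite ler_pM2l// lerXn2r// nnegrE ltW.
rewrite [leLHS](_ : _ = 5 * C * (B ^+ i * B ^+ (t * m - (k * m + i)))); last by ring.
by rewrite -exprD subnDA subnKC// leq_subRL// (leq_trans _ lt1)// leq_addr.
Qed.

Lemma sample_nonempty : (0 < #|T|)%N.
Proof.
have [_ tot _] := fP; rewrite card_ord -(ltr_nat R) -(pmulr_rgt0 _ C0).
by apply: lt_le_trans tot; rewrite exprn_gt0//; move: B2; lra.
Qed.

(** A piece has diameter at most 4 cells when projected. *)
Lemma proj_cell_nine (k : nat) (M : nat) (Q : T -> 'I_M) :
  (forall p q, Q p = Q q -> close (f p) (f q) (2 / 2 ^+ (k * m))) ->
  forall j q, exists g : T -> 'I_9, forall p p', Q p = Q q -> Q p' = Q q ->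
     g p = g p' -> proj_cell k j p = proj_cell k j p'.
Proof.
move=> QP j q; pose d p := proj_cell k j p - proj_cell k j q.
have k0 : (0 : R) < 2 ^+ (k * m) by rewrite exprn_gt0.
have dP p : Q p = Q q -> - 4%:Z <= d p <= 4%:Z.
  move=> /QP /andP[nx ny]; apply: floor_offset.
  rewrite -mulrBr normrM gtr0_norm// [X in _ * `|X|](_ : _ =
    (cx (f p) - cx (f q)) + a j * (cy (f p) - cy (f q))); last by ring.
  rewrite mulrC -ler_pdivlMr// (le_trans (ler_normD _ _))// normrM.
  have /andP[a0 a1] := slope01 (aj j); rewrite (ger0_norm a0).
  have : a j * `|cy (f p) - cy (f q)| <= `|cy (f p) - cy (f q)| by rewrite ler_piMl.
  have -> : 4 / 2 ^+ (k * m) = 2 / 2 ^+ (k * m) + 2 / 2 ^+ (k * m) :> R.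
    by field; rewrite gt_eqF.
  lra.
exists (fun p => inord (absz (d p + 4%:Z))) => p p' /dP dp /dP dp' e.
exact: (inord_offset_inj (k := 4) e dp dp').
Qed.

(** Entropy gained from level k to level k + 1, summed over the slopes. By
    submodularity it is at least the gain given the piece Q; the cell at level
    k + 1 given Q has large entropy on average ([energy_bound] and Jensen), and the
    cell at level k given Q has entropy at most ln 9. *)
Lemma entropy_step (k : nat) : (k < t)%N ->
  (2 ^ m)%:R * #|T|%:R * (m%:R * ln 2 - ln (45 * C ^+ 3 * m.+1%:R)) <=
  \sum_j (sum_ln_fiber (proj_cell k j) - sum_ln_fiber (proj_cell k.+1 j)) :> R.
Proof.
move=> kt; have [_ _ nets] := fP; have [M [Q [MC QP]]] := nets (k * m)%N.
pose V : R := 5 * C ^+ 3 * m.+1%:R / (2 ^ m)%:R.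
have m2 : (0 : R) < (2 ^ m)%:R by rewrite ltr0n expn_gt0.
have T0 := sample_nonempty; have N0 : (0 : R) < #|T|%:R by rewrite ltr0n.
have C3 : 0 < C ^+ 3 by rewrite exprn_gt0.
have V0 : 0 < V by rewrite divr_gt0// !mulr_gt0.
pose x (jp : 'I_(2 ^ m) * T) : R :=
  (fiber_size (fun q => (proj_cell k.+1 jp.1 q, Q q)) jp.2)%:R / (fiber_size Q jp.2)%:R.
have x0 jp : 0 < x jp by rewrite divr_gt0// fiber_size_gt0r.
have cJT : #|{: 'I_(2 ^ m) * T}| = (2 ^ m * #|T|)%N by rewrite card_prod !card_ord.
have E : \sum_j (sum_ln_fiber (fun q => (proj_cell k.+1 j q, Q q)) - sum_ln_fiber Q) <=
    (2 ^ m)%:R * #|T|%:R * ln V.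
  have := @sum_ln_le R _ x V; rewrite cJT natrM => /(_ _ x0).
  rewrite muln_gt0 expn_gt0/= T0 => /(_ isT).
  rewrite -(pair_bigA _ (fun j p => x (j, p)))/= -(pair_bigA _ (fun j p => ln (x (j, p))))/=.
  rewrite mulrA [V * _](_ : _ = 5 * C ^+ 3 * m.+1%:R); last by rewrite /V divfK// gt_eqF.
  move=> /(_ (energy_bound kt MC QP)); apply: le_trans.
  apply: ler_sum => j _; rewrite /sum_ln_fiber -sumrB; apply: ler_sum => p _.
  by rewrite /x ln_div ?posrE ?fiber_size_gt0r.
have F j : - (sum_ln_fiber (fun q => (proj_cell k.+1 j q, Q q)) - sum_ln_fiber Q) - #|T|%:R * ln 9 <=
    sum_ln_fiber (proj_cell k j) - sum_ln_fiber (proj_cell k.+1 j) :> R.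
  have := @sum_ln_fiber_submod R _ _ _ _ _ _ Q T0 (@proj_cell_refine k j).
  have := @sum_ln_fiber_pair_le R _ _ _ (proj_cell k j) Q 9 T0 (proj_cell_nine QP j).
  lra.
have : \sum_j (- (sum_ln_fiber (fun q => (proj_cell k.+1 j q, Q q)) - sum_ln_fiber Q) - #|T|%:R * ln 9) <=
    \sum_j (sum_ln_fiber (proj_cell k j) - sum_ln_fiber (proj_cell k.+1 j)) :> R.
  by apply: ler_sum => j _; exact: F.
rewrite sumrB sumrN sumr_const (card_ord (2 ^ m)) -[X in _ - X]mulr_natl.
have -> : ln (45 * C ^+ 3 * m.+1%:R) = ln V + m%:R * ln 2 + ln 9.
  have -> : 45 * C ^+ 3 * m.+1%:R = V * 2 ^+ m * 9.
    by rewrite /V natrX; field; rewrite expf_neq0.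
  by rewrite !lnM ?posrE ?mulr_gt0 ?exprn_gt0// lnXn// mulr_natl.
move: E; set A := \sum_j _; set D := \sum_j _; nra.
Qed.

Lemma entropy_bound (W : R) :
  (forall j, \sum_p (fiber_size (proj_cell t j) p)%:R^-1 <= W) ->
  t%:R * (m%:R * ln 2 - ln (45 * C ^+ 3 * m.+1%:R)) <= ln W.
Proof.
move=> HW.
have m2 : (0 : R) < (2 ^ m)%:R by rewrite ltr0n expn_gt0.
have T0 := sample_nonempty; have N0 : (0 : R) < #|T|%:R by rewrite ltr0n.
rewrite -(ler_pM2l (mulr_gt0 m2 N0)) mulrCA.
apply: (@le_trans _ _ (\sum_(k < t) \sum_j
    (sum_ln_fiber (proj_cell k j) - sum_ln_fiber (proj_cell k.+1 j)))).
  rewrite [leLHS](_ : _ = \sum_(k < t) ((2 ^ m)%:R * #|T|%:R * (m%:R * ln 2 - ln (45 * C ^+ 3 * m.+1%:R)))).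
    by apply: ler_sum => k _; exact: entropy_step (ltn_ord k).
  by rewrite sumr_const (card_ord t) -[RHS]mulr_natl.
rewrite exchange_big/= [leRHS](_ : _ = \sum_(j < 2 ^ m) (#|T|%:R * ln W)); last first.
  by rewrite sumr_const (card_ord (2 ^ m)) -[RHS]mulr_natl mulrA.
apply: ler_sum => j _.
rewrite -(big_mkord xpredT (fun k => sum_ln_fiber (proj_cell k j) - sum_ln_fiber (proj_cell k.+1 j))).
have -> : \sum_(0 <= k < t) (sum_ln_fiber (proj_cell k j) - sum_ln_fiber (proj_cell k.+1 j)) =
    sum_ln_fiber (proj_cell 0 j) - sum_ln_fiber (proj_cell t j) :> R.
  elim: (t) => [|n IH]; first by rewrite big_geq// subrr.
  by rewrite big_nat_recr//= IH; ring.
have := sum_ln_fiber_ge T0 (HW j); have := @sum_ln_fiber_le R _ _ (proj_cell 0 j); lra.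
Qed.

End ProjectionEntropy.

(** * Regular samples of an Ahlfors-David regular set *)

Section Support.
Context {R : realType} (s : R) (K : set 'rV[R]_2).
Local Open Scope ereal_scope.
Let mu := hausdorff_restr s K.
Let S := msupport mu.
Let H : set 'rV[R]_2 -> \bar R := hausdorff_measure s.

Lemma support_approx x (e : R) : S x -> (0 < e)%R ->
  exists y, [/\ K y, `|cx x - cx y| < e & `|cy x - cy y| < e]%R.
Proof.
move=> Sx e0; have xU : (ball x e)^° x by exact: nbhsx_ballx.
have := Sx _ (@open_interior _ (ball x e)) xU; rewrite /mu/= /hausdorff_restr.
have [->|/set0P[y [/interior_subset By Ky]] _] := eqVneq ((ball x e)^° `&` K) set0.
  by rewrite hausdorff_measure0 ltxx.
by move: By => /(ball_coordP _ _ e0)[? ?]; exists y.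
Qed.

(** A point off the support lies in a dyadic square that K meets in a null set,
    and there are countably many dyadic squares. *)
Lemma hausdorff_off_support : H (K `\` S) = 0.
Proof.
pose cell (c : nat * int * int) : set 'rV[R]_2 :=
  [set x | Num.floor (2 ^+ c.1.1 * cx x) = c.1.2 /\ Num.floor (2 ^+ c.1.1 * cy x) = c.2]%R.
pose F n : set 'rV[R]_2 := if unpickle n is Some c then
  if H (cell c `&` K) == 0 then cell c `&` K else set0 else set0.
apply: (@hausdorff_cover0 _ _ F) => [n|x [Kx /existsNP[U /not_implyP[oU /not_implyP[Ux muU]]]]].
  rewrite /F; case: unpickle => [c|]; last exact: hausdorff_measure0.
  by case: ifPn => [/eqP //|_]; exact: hausdorff_measure0.
have U0 : H (U `&` K) = 0.
  by apply/eqP; rewrite eq_le hausdorff_measure_ge0 andbT leNgt; apply/negP.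
have /nbhs_ballP[e /= e0 eU] := open_nbhs_nbhs (conj oU Ux).
have [l le] : exists l, (1 < e * 2 ^+ l)%R.
  exists (Num.truncn e^-1).+1; rewrite -ltr_pdivrMl// mulr1.
  apply: (lt_trans (truncnS_gt _)); rewrite -natrX ltr_nat; exact: ltn_expl.
have l0 : (0 < 2 ^+ l :> R)%R by rewrite exprn_gt0.
pose c := (l, Num.floor (2 ^+ l * cx x)%R, Num.floor (2 ^+ l * cy x)%R).
have floor_close (u v : R) : Num.floor (2 ^+ l * v)%R = Num.floor (2 ^+ l * u)%R ->
    (`|u - v| < e)%R.
  move=> f; have := floor_itv (2 ^+ l * u)%R; have := floor_itv (2 ^+ l * v)%R.
  rewrite f intrD => /andP[h1 h2] /andP[h3 h4].
  by rewrite ltr_norml; apply/andP; split; rewrite -(ltr_pM2r l0); lra.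
have cU : cell c `<=` U.
  move=> y [/= f1 f2]; apply: eU; apply/ball_coordP => //.
  by split; exact: floor_close.
exists (pickle c) => //; rewrite /F pickleK.
rewrite (_ : H (cell c `&` K) = 0) ?eqxx//.
apply/eqP; rewrite eq_le hausdorff_measure_ge0 andbT -U0.
by apply: le_hausdorff_measure => y [? ?]; split => //; exact: cU.
Qed.

Lemma hausdorff_le_support A : K `&` S `<=` A -> H K <= H A.
Proof.
move=> SA; apply: (@le_trans _ _ (H (A `|` (K `\` S)))).
  apply: le_hausdorff_measure => x Kx.
  by have [Sx|Sx] := pselect (S x); [left; exact: SA|right].
apply: (le_trans (outer_measureU2 (H : {outer_measure set _ -> \bar R}) _ _)).
by rewrite [X in _ + X]hausdorff_off_support adde0.
Qed.

Lemma support_two_points : (0 < s)%R -> 0 < H K ->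
  exists x y, [/\ S x, S y & x != y].
Proof.
move=> s0 HK; have [x Sx] : exists x, S x.
  apply: contrapT => nS; move: HK; rewrite ltNge; move/negP; apply.
  rewrite -(hausdorff_measure0 s : H set0 = 0); apply: hausdorff_le_support => x [_ Sx].
  by apply: nS; exists x.
exists x; apply: contrapT => nS; move: HK; rewrite ltNge; move/negP; apply.
rewrite -(hausdorff_measure1 x s0); apply: hausdorff_le_support => y [_ Sy] /=.
by apply: contrapT => /eqP yx; apply: nS; exists y; split => //; rewrite eq_sym.
Qed.

(** Regularity at the dyadic scales, without restriction on the radius. The
    hypothesis is limited to radii at most the diameter of the support, but this
    diameter is positive, as points are null, and the measure of K is finite; so
    larger radii only change the constant. The factor 8 leaves room for the passage
    from squares to discs. *)
Lemma AD_dyadic (C : R) : (1 <= s)%R -> (1 <= C)%R -> AD_regular_measure s C mu ->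
  0 < H K < +oo ->
  exists2 D : R, (0 < D)%R & forall x (l : nat), S x ->
    ((D * (2 `^ s) ^+ l)^-1)%:E <= mu (ecball x (2 ^+ l)^-1) /\
    mu (ecball x (8 / 2 ^+ l)) <= (D / (2 `^ s) ^+ l)%:E.
Proof.
move=> s1 C1 AD /andP[HK0 HKoo].
have s0 : (0 < s)%R by lra.
have C0 : (0 < C)%R by lra.
have [x [y [Sx Sy xy]]] := support_two_points s0 HK0.
pose r0 := enorm (x - y); have r00 : (0 < r0)%R by rewrite enorm_gt0// subr_eq0.
have r0d : r0%:E <= ediam S by apply: ereal_sup_ubound; exists (x, y).
have {}AD z r : S z -> (0 < r)%R -> (r <= r0)%R ->
    (r `^ s / C)%:E <= mu (ecball z r) <= (C * r `^ s)%:E.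
  move=> Sz r1 r2; apply: AD => //; apply: le_trans r0d; by rewrite lee_fin.
have HKf : H K \is a fin_num by rewrite ge0_fin_numE// hausdorff_measure_ge0.
pose h := fine (H K); have hE : H K = h%:E by rewrite fineK.
have h0 : (0 <= h)%R by rewrite -lee_fin -hE ltW.
have p2 : (0 < 2 `^ s :> R)%R by rewrite powR_gt0.
have pr0 : (0 < r0 `^ s)%R by rewrite powR_gt0.
have p8 : (0 < 8 `^ s :> R)%R by rewrite powR_gt0.
have muK A : mu A <= h%:E.
  by rewrite -hE; apply: le_hausdorff_measure => ? [].
have dyad l : ((2 ^+ l)^-1 `^ s = ((2 `^ s) ^+ l)^-1 :> R)%R.
  have -> : ((2 ^+ l)^-1 = 2 `^ (- l%:R) :> R)%R by rewrite powR_invn.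
  by rewrite -powRrM mulNr mulrC powRN powRrM powR_mulrn// powR_ge0.
have dyad8 l : ((8 / 2 ^+ l) `^ s = 8 `^ s / (2 `^ s) ^+ l :> R)%R.
  by rewrite powRM ?dyad// invr_ge0 exprn_ge0.
pose D := (C + C / r0 `^ s + C * 8 `^ s + h * 8 `^ s / r0 `^ s)%R.
have q1 : (0 < C / r0 `^ s)%R by rewrite divr_gt0.
have q2 : (0 < C * 8 `^ s)%R by rewrite mulr_gt0.
have q3 : (0 <= h * 8 `^ s / r0 `^ s)%R by rewrite divr_ge0 ?mulr_ge0// ltW.
have D0 : (0 < D)%R by rewrite /D; lra.
exists D => // z l Sz.
have pl : (0 < (2 `^ s) ^+ l :> R)%R by rewrite exprn_gt0.
have i0 : (0 < (2 ^+ l)^-1 :> R)%R by rewrite invr_gt0 exprn_gt0.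
split.
- have [lr|rl] := leP (2 ^+ l)^-1%R r0.
    have /andP[h1 _] := AD z _ Sz i0 lr; apply: le_trans h1.
    rewrite lee_fin dyad -invfM lef_pV2 ?posrE ?mulr_gt0//.
    by rewrite mulrC ler_pM2r// /D; lra.
  apply: (@le_trans _ _ (mu (ecball z r0))); last first.
    apply: le_hausdorff_measure => w [hw Kw]; split => //.
    exact: le_trans (hw : (enorm _ <= _)%R) (ltW rl).
  have /andP[h1 _] := AD z _ Sz r00 (lexx _); apply: le_trans h1.
  rewrite lee_fin -[leRHS]invf_div lef_pV2 ?posrE ?q1 ?(mulr_gt0 D0)//.
  apply: (@le_trans _ _ D); first by rewrite /D; lra.
  rewrite ler_peMr ?(ltW D0)// exprn_ege1// -[leLHS](powRr0 2).
  by rewrite ler_powR ?ler1n// ltW.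
- have [lr|rl] := leP (8 / 2 ^+ l)%R r0.
    have /andP[_ h1] := AD z _ Sz (divr_gt0 (ltr0Sn _ 7) (exprn_gt0 l (ltr0Sn R 1))) lr.
    apply: (le_trans h1); rewrite lee_fin dyad8 mulrA.
    by rewrite ler_pM2r ?invr_gt0// /D; lra.
  apply: (le_trans (muK _)); rewrite lee_fin.
  have r8 : (r0 `^ s <= 8 `^ s / (2 `^ s) ^+ l)%R.
    rewrite -dyad8; apply: ge0_ler_powR; [exact: ltW|by rewrite nnegrE ltW| |exact: ltW].
    by rewrite nnegrE divr_ge0// exprn_ge0.
  apply: (@le_trans _ _ (h * 8 `^ s / r0 `^ s / (2 `^ s) ^+ l)%R); last first.
    by rewrite ler_pM2r ?invr_gt0// /D; lra.
  have -> : (h * 8 `^ s / r0 `^ s / (2 `^ s) ^+ l = h * (8 `^ s / (2 `^ s) ^+ l / r0 `^ s))%R by ring.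
  by rewrite ler_peMr// ler_pdivlMr// mul1r.
Qed.

End Support.

Section Nets.
Context {R : realType} (s : R) (K : set 'rV[R]_2).
Let mu := hausdorff_restr s K.
Let S := msupport mu.
Let B : R := 2 `^ s.
Context (D h : R).
Hypotheses (D0 : 0 < D) (h0 : 0 < h) (hE : hausdorff_measure s K = h%:E).
Hypothesis lower : forall x (l : nat), S x ->
  ((D * B ^+ l)^-1%:E <= mu (ecball x (2 ^+ l)^-1))%E.
Hypothesis upper : forall x (l : nat), S x ->
  (mu (ecball x (8 / 2 ^+ l)) <= (D / B ^+ l)%:E)%E.

Definition separated (r : R) N (f : 'I_N -> 'rV[R]_2) :=
  forall i j, i != j -> ~~ close (f i) (f j) r.

Let B0 : 0 < B. Proof. by rewrite powR_gt0. Qed.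

(** Half-size discs around separated points are disjoint and have a definite
    measure. *)
Lemma packing N (f : 'I_N -> 'rV[R]_2) l (E : set (borel_rV R 2)) (V : R) :
  (forall i, S (f i)) -> separated (2 ^+ l)^-1 f ->
  (forall i, ecball (f i) (2 ^+ l.+1)^-1 `<=` E) -> measurable E ->
  (mu E <= V%:E)%E -> N%:R <= D * B ^+ l.+1 * V.
Proof.
move=> Sf sep fE mE EV.
pose F i : set (borel_rV R 2) := ecball (f i) (2 ^+ l.+1)^-1.
have mF i : measurable (F i) by exact: measurable_ecball.
have tF : trivIset setT F.
  apply/trivIsetP => i j _ _ ij; apply/seteqP; split => // z [Fi Fj].
  have /negP := sep _ _ ij; apply.
  have -> : (2 ^+ l)^-1 = (2 ^+ l.+1)^-1 + (2 ^+ l.+1)^-1 :> R.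
    by rewrite exprS; field; rewrite expf_neq0.
  by apply: (@close_trans _ z); [exact: ecball_close|rewrite close_sym; exact: ecball_close].
have DB : 0 < D * B ^+ l.+1 by rewrite mulr_gt0// exprn_gt0.
have : ((N%:R * (D * B ^+ l.+1)^-1)%:E <= V%:E)%E.
  apply: le_trans EV; apply: (@le_trans _ _ (mu (\big[setU/set0]_(i < N) F i))); last first.
    apply: le_measure; rewrite ?inE//.
      by apply: bigsetU_measurable.
    by elim/big_ind : _ => [//|A1 A2 h1 h2 z [/h1|/h2]//|i _]; exact: fE.
  have -> : mu (\big[setU/set0]_(i < N) F i) = (\sum_(i < N) mu (F i))%E.
    by apply: (measure_semi_additive_ord (hausdorff_restr s K)) => //; exact: bigsetU_measurable.
  apply: (@le_trans _ _ (\sum_(i < N) ((D * B ^+ l.+1)^-1)%:E)%E).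
    by rewrite sumEFin sumr_const card_ord mulr_natl.
  by apply: lee_sum => i _; exact: lower.
by rewrite lee_fin ler_pdivrMr// mulrC.
Qed.

Lemma restr_le A : (mu A <= h%:E)%E.
Proof. by rewrite -hE; apply: le_hausdorff_measure => ? []. Qed.

(** Packing bounds the size of separated families, and a family of maximal
    size is a net. *)
Lemma max_net l : exists N (f : 'I_N -> 'rV[R]_2),
  [/\ forall i, S (f i), separated (2 ^+ l)^-1 f &
      forall x, S x -> exists i, close x (f i) (2 ^+ l)^-1].
Proof.
pose P N := `[< exists f : 'I_N -> 'rV[R]_2,
  (forall i, S (f i)) /\ separated (2 ^+ l)^-1 f >].
have P0 : exists N, P N.
  exists 0; apply/asboolP; exists (fun=> 0); split; by case.
have Pb N : P N -> (N <= Num.truncn (D * B ^+ l.+1 * h))%N.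
  move=> /asboolP[f [Sf sf]]; rewrite -ltnS -(ltr_nat R).
  apply: le_lt_trans (truncnS_gt _); by apply: (@packing N f l setT h Sf sf) => //; exact: restr_le.
case: (ex_maxnP P0 Pb) => N /asboolP[f [Sf sf]] Nmax.
exists N, f; split => // x Sx; apply: contrapT => nx.
have nx' i : ~~ close x (f i) (2 ^+ l)^-1.
  by apply/negP => c; apply: nx; exists i.
suff /Nmax : P N.+1 by rewrite ltnn.
apply/asboolP; exists (fun i => if unlift ord_max i is Some j then f j else x); split.
  by move=> i; case: unliftP.
move=> i j; case: unliftP => [i' ->|->]; case: unliftP => [j' ->|->] ij //.
- by apply: sf; apply: contraNneq ij => ->.
- by rewrite close_sym.
- by rewrite eqxx in ij.
Qed.

Let C := D ^+ 2 * B + h * D * B + D / h.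

(** The sample is a maximal 2^-n-separated family; its pieces at scale 2^-l send
    a point to a nearby point of a maximal 2^-l-separated family. *)
Lemma regular_sample_exists n : exists N (f : 'I_N -> 'rV[R]_2),
  (forall i, S (f i)) /\ regular_sample B C n f.
Proof.
have c1 : 0 < D ^+ 2 * B by rewrite mulr_gt0// exprn_gt0.
have c2 : 0 < h * D * B by rewrite !mulr_gt0.
have c3 : 0 < D / h by rewrite divr_gt0.
have [N [f [Sf sf cf]]] := max_net n; exists N, f; split => //; split.
- move=> p l ln; set A := [pred q | _].
  pose g (i : 'I_#|A|) := f (enum_val i).
  have gA i : close (f p) (g i) (2 / 2 ^+ l) by have := enum_valP i; rewrite inE.
  apply: (@le_trans _ _ (D * B ^+ n.+1 * (D / B ^+ l))).
    apply: (@packing _ g n (ecball (f p) (8 / 2 ^+ l))).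
    + by move=> i; exact: Sf.
    + by move=> i j ij; apply: sf; rewrite (inj_eq enum_val_inj).
    + move=> i z zi; have nl : (2 ^+ n.+1)^-1 <= (2 ^+ l)^-1 :> R.
        by rewrite lef_pV2 ?posrE ?exprn_gt0// ler_weXn2l ?ler1n// ltnW.
      have : close (f p) z (4 / 2 ^+ l).
        have /andP[h1 h2] := close_trans (gA i) (ecball_close zi).
        have i0 : 0 < (2 ^+ l)^-1 :> R by rewrite invr_gt0 exprn_gt0.
        by apply/andP; split; lra.
      by move=> /close_ecball; rewrite (_ : 2 * (4 / 2 ^+ l) = 8 / 2 ^+ l)//; lra.
    + exact: measurable_ecball.
    + exact: upper.
  rewrite [leLHS](_ : _ = D ^+ 2 * B * B ^+ (n - l)); last first.
    rewrite -{1}(subnK ln) -addSn exprD exprS.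
    by field; rewrite gt_eqF ?exprn_gt0.
  by rewrite ler_pM2r ?exprn_gt0// /C; lra.
- have : (h%:E <= (N%:R * (D / B ^+ n))%:E)%E.
    pose F k := oapp (fun i : 'I_N => ecball (f i) (8 / 2 ^+ n) `&` K) set0 (insub k).
    rewrite -hE; apply: (@le_trans _ _ (hausdorff_measure s (\big[setU/set0]_(i < N) F i))).
      apply: hausdorff_le_support => x [Kx Sx].
      have [i xi] := cf _ Sx; rewrite -bigcup_mkord; exists i => //=.
      rewrite /F valK/=; split => //.
      have := close_ecball (etrans (close_sym _ _ _) xi).
      rewrite /ecball/= => /le_trans; apply.
      by rewrite ler_pM2r ?invr_gt0 ?exprn_gt0//; lra.
    apply: (le_trans (outer_measure_subadditive (hausdorff_measure s : {outer_measure set _ -> \bar R}) F N)).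
    rewrite mulr_natl -[X in _ *+ X](card_ord N) -sumr_const -sumEFin.
    by apply: lee_sum => i _; rewrite /F valK/=; exact: upper.
  rewrite lee_fin mulrA ler_pdivlMr ?exprn_gt0// -ler_pdivlMl// => H.
  apply: (le_trans H); rewrite [leLHS](_ : _ = D / h * N%:R); last by ring.
  by rewrite ler_wpM2r// /C; lra.
- move=> l; have [M [g [Sg sg cg]]] := max_net l.
  have cg' p : exists i, close (f p) (g i) (2 ^+ l)^-1 by exact: cg.
  pose Q p := sval (cid (cg' p)).
  have QP p : close (f p) (g (Q p)) (2 ^+ l)^-1 := svalP (cid (cg' p)).
  exists M, Q; split.
    apply: (@le_trans _ _ (D * B ^+ l.+1 * h)).
      by apply: (@packing M g l setT h Sg sg) => //; exact: restr_le.
    rewrite [leLHS](_ : _ = h * D * B * B ^+ l); last by rewrite exprS; ring.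
    by rewrite ler_pM2r ?exprn_gt0// /C; lra.
  move=> p q Qpq; have -> : 2 / 2 ^+ l = (2 ^+ l)^-1 + (2 ^+ l)^-1 :> R by lra.
  by apply: close_trans (QP p) _; rewrite Qpq close_sym.
Qed.

End Nets.

(** * Bounds on the upper box dimension *)

Section BoxDimension.
Context {R : realType}.
Implicit Types (B : set R) (A delta e : R).

Lemma covering_number_le B delta n :
  ball_cover B delta n -> (covering_number B delta <= n)%N.
Proof.
move=> Bn; rewrite /covering_number; case: xgetP => [m _ [_ mmin]|no]; first exact: mmin.
have ex : exists n, `[< ball_cover B delta n >] by exists n; exact/asboolP.
case: (ex_minnP ex) => k /asboolP Bk kmin; exfalso; apply: (no k); split => // m /asboolP.
exact: kmin.
Qed.

Lemma covering_number_cover B delta n :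
  ball_cover B delta n -> ball_cover B delta (covering_number B delta).
Proof.
move=> Bn; rewrite /covering_number; case: xgetP => [m _ [Bm _]//|no].
have ex : exists n, `[< ball_cover B delta n >] by exists n; exact/asboolP.
case: (ex_minnP ex) => k /asboolP Bk kmin; exfalso; apply: (no k); split => // m /asboolP.
exact: kmin.
Qed.

Lemma bounded_ball_cover B A delta : 0 < delta -> 0 <= A ->
  (forall y, B y -> `|y| <= A) ->
  ball_cover B delta (Num.truncn (2 * A / delta)).+1.
Proof.
move=> d0 A0 BA; exists (fun i => - A + i%:R * delta) => y By.
have := BA y By; rewrite ler_norml => /andP[y1 y2].
pose z := (y + A) / delta.
have z0 : 0 <= z by rewrite divr_ge0 ?(ltW d0)//; lra.
have /andP[z1 z2] := truncn_itv z0.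
have zE : z * delta = y + A by rewrite divfK// gt_eqF.
have zn : (Num.truncn z < (Num.truncn (2 * A / delta)).+1)%N.
  rewrite ltnS; apply: le_truncn; rewrite /z ler_pM2r ?invr_gt0//; lra.
exists (Ordinal zn) => //=; rewrite -ball_normE/=.
have h1 : (Num.truncn z)%:R * delta <= z * delta by rewrite ler_pM2r.
have h2 : z * delta < (Num.truncn z).+1%:R * delta by rewrite ltr_pM2r.
rewrite -natr1 in h2; rewrite ltr_norml/=; apply/andP; split; lra.
Qed.

Lemma upper_box_dim_le1 B A : 0 <= A -> (forall y, B y -> `|y| <= A) ->
  (upper_box_dim B <= 1)%E.
Proof.
move=> A0 BA; apply/lee_addgt0Pr => e e0.
have l0 : 0 <= ln (2 * A + 1) by apply: ln_ge0; lra.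
pose d0 : R := Num.min (1 / 2) (expR (- (ln (2 * A + 1) / e))).
have d00 : 0 < d0 by rewrite lt_min expR_gt0; apply/andP; split => //; lra.
pose V := [set d : R | 0 < d /\ d < d0].
apply: (@le_trans _ _ (ereal_sup [set (ln (covering_number B d)%:R / - ln d)%:E | d in V])).
  apply: ereal_inf_lbound; exists V => //.
  near=> d; split; near: d; [exact: nbhs_right_gt|exact: nbhs_right_lt].
apply: ge_ereal_sup => _ [d [dgt dlt] <-].
move: dlt; rewrite lt_min => /andP[d12 dexp].
have lnd : ln d < - (ln (2 * A + 1) / e) by rewrite -(expRK (- _)) ltr_ln ?posrE ?expR_gt0.
have lnd0 : ln d < 0 by rewrite ln_lt0//; apply/andP; split => //; lra.
rewrite -EFinD lee_fin ler_pdivrMr; last by lra.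
have N1 : (covering_number B d)%:R <= (2 * A + 1) / d.
  apply: (@le_trans _ _ (Num.truncn (2 * A / d)).+1%:R).
    by rewrite ler_nat; apply: covering_number_le; exact: bounded_ball_cover.
  rewrite -[leLHS]natr1 [leRHS]mulrDl; apply: lerD.
    by rewrite truncn_le// divr_ge0 ?(ltW dgt)//; lra.
  by rewrite ler_pdivlMr//; lra.
have lnN : ln (covering_number B d)%:R <= ln (2 * A + 1) - ln d.
  have [->|N0] := posnP (covering_number B d); first by rewrite ln0//; lra.
  rewrite -ln_div ?posrE//; last by lra.
  by rewrite ler_ln ?posrE ?ltr0n ?divr_gt0//; lra.
have : ln (2 * A + 1) < e * - ln d by rewrite -ltr_pdivrMl// mulrC; lra.
lra.
Unshelve. all: by end_near.
Qed.

(** A limit superior only needs arbitrarily small good scales, which may depend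
    on the loss e. *)
Lemma upper_box_dim_ge1 B A : 0 <= A -> (forall y, B y -> `|y| <= A) ->
  (forall e d0, 0 < e -> 0 < d0 -> exists2 d, 0 < d < Num.min d0 1 &
    forall n, ball_cover B d n -> (1 - e) * - ln d <= ln n%:R) ->
  (1 <= upper_box_dim B)%E.
Proof.
move=> A0 BA H; apply: le_ereal_inf_tmp => _ [V V0 <-].
have [d0 d00 dV] : exists2 d0, 0 < d0 & forall d, 0 < d -> d < d0 -> V d.
  have /nbhs_ballP[d0 /= d00 dV] := V0; exists d0 => // d d1 d2.
  by apply: (dV d) => //=; rewrite -ball_normE/= sub0r normrN gtr0_norm.
apply/lee_subgt0Pr => e e0.
have [d /andP[d1 d2] dN] := H e d0 e0 d00.
move: d2; rewrite lt_min => /andP[d2 d3].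
apply: (@le_trans _ _ (ln (covering_number B d)%:R / - ln d)%:E); last first.
  by apply: ereal_sup_ubound; exists d => //; exact: dV.
have lnd0 : ln d < 0 by rewrite ln_lt0// d1.
rewrite -EFinB lee_fin ler_pdivlMr; last by lra.
apply: dN; apply: covering_number_cover; exact: bounded_ball_cover d1 A0 BA.
Qed.

End BoxDimension.

(** * A point that sees K in a dense set of directions *)

Section DenseDirections.
Context {R : realType}.

(** For p < q the two factors have the same nonzero sign exactly when u has a
    slope in (p, q); this form is free of divisions and symmetric under u -> - u. *)
Definition slope_between (p q : R) (u : 'rV[R]_2) :=
  0 < (cy u - p * cx u) * (q * cx u - cy u).

Lemma slope_betweenP p q u : p < q -> slope_between p q u ->
  exists2 a, p < a < q & cx u != 0 /\ cy u = a * cx u.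
Proof.
rewrite /slope_between => pq; set x := cx u; set y := cy u.
have [->|x0 vw] := eqVneq x 0.
  by rewrite !mulr0 subr0 sub0r mulrN oppr_gt0 ltNge -expr2 sqr_ge0.
have yE : y = y / x * x by rewrite divfK.
exists (y / x) => //; move: vw; rewrite {1 2}yE; move: (y / x) => a.
rewrite -!mulrBl mulrACA pmulr_lgt0; last by rewrite -expr2 exprn_even_gt0.
by move=> h; apply/andP; split; nra.
Qed.

(** The loss ln (c (m + 1)) at each level is negligible against m ln 2; the proof
    uses ln y = 2 ln (sqrt y) <= 2 sqrt y. *)
Lemma ln_natS_small (c e : R) : 0 < c -> 0 < e ->
  exists2 m : nat, (0 < m)%N & ln (c * m.+1%:R) <= e * m%:R.
Proof.
move=> c0 e0; pose m := (Num.truncn (8 * c / e ^+ 2)).+1.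
exists m => //.
have mP : 8 * c / e ^+ 2 < m%:R by exact: truncnS_gt.
have e2 : 0 < e ^+ 2 by rewrite exprn_gt0.
have m0 : (0 < m)%N by [].
have m1 : (1 : R) <= m%:R by rewrite ler1n.
clearbody m; have m1' : (m.+1%:R : R) <= 2 * m%:R by rewrite -natr1; lra.
set y := c * _; have y0 : 0 < y by rewrite mulr_gt0.
have s0 : 0 < Num.sqrt y by rewrite sqrtr_gt0.
have -> : ln y = ln (Num.sqrt y) *+ 2 by rewrite -lnXn// sqr_sqrtr// ltW.
have h1 := ln_le_subr1 s0.
have h2 : 2 * Num.sqrt y <= e * m%:R.
  rewrite -(@ler_pXn2r _ 2)// ?nnegrE ?mulr_ge0 ?(ltW s0) ?(ltW e0)//.
  rewrite !exprMn sqr_sqrtr ?(ltW y0)//.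
  have h3 : 8 * c < m%:R * e ^+ 2 by rewrite -ltr_pdivrMr.
  have h4 : 8 * c * m%:R <= m%:R * e ^+ 2 * m%:R by apply: ler_wpM2r; lra.
  have h5 : y <= c * (2 * m%:R) by rewrite ler_pM2l.
  lra.
rewrite mulr2n; lra.
Qed.

Lemma finite_lower_bound (I : finType) (x : I -> R) : (forall i, 0 < x i) ->
  exists2 r, 0 < r & forall i, r <= x i.
Proof.
move=> x0; pose y := 1 + \sum_i (x i)^-1.
have s0 : 0 <= \sum_i (x i)^-1 by apply: sumr_ge0 => i _; rewrite invr_ge0 ltW.
have y0 : 0 < y by rewrite /y; lra.
exists y^-1; first by rewrite invr_gt0.
move=> i; rewrite invf_ple ?posrE//; rewrite /y (bigD1 i)//=.
have : 0 <= \sum_(j | j != i) (x j)^-1 by apply: sumr_ge0 => j _; rewrite invr_ge0 ltW.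
by have := x0 i; lra.
Qed.

Context (K S : set 'rV[R]_2) (B C : R) (x0 : 'rV[R]_2).
Hypothesis B2 : 2 <= B.
Hypothesis C0 : 0 < C.
Hypothesis S_near : forall x (e : R), S x -> 0 < e ->
  exists y, [/\ K y, `|cx x - cx y| < e & `|cy x - cy y| < e].
Hypothesis samples : forall n, exists N (f : 'I_N -> 'rV[R]_2),
  (forall i, S (f i)) /\ regular_sample B C n f.
Hypothesis dense : forall m j, (j < 2 ^ m)%N ->
  exists2 x, K x & slope_between (j%:R / 2 ^+ m) (j.+1%:R / 2 ^+ m) (x - x0).

(** The number m of digits per level is chosen from e, then one point y j of K
    per slope interval, and only then the scale d = 2^-(t m). A cover by n0
    intervals of length 2 d of K . (K - x0) covers all the projections, each
    interval meeting at most c cells, where c depends on the points y j only; hence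
    [entropy_bound] bounds ln (n0 c) from below. *)
Lemma dense_directions_cover (e d0 : R) : 0 < e -> 0 < d0 ->
  exists2 d, 0 < d < Num.min d0 1 &
    forall n, ball_cover (dot_diff_set K x0) d n -> (1 - e) * - ln d <= ln n%:R.
Proof.
move=> e0 d00; have B0 : 0 < B by move: B2; lra.
(* half of the loss e pays for the entropy lost at each level, the other half for
   the constant c. *)
have ln2 : 0 < ln 2 :> R by rewrite ln_gt0// ltr1n.
have c0 : 0 < 45 * C ^+ 3 by rewrite mulr_gt0// exprn_gt0.
have [m m0 mP] := ln_natS_small c0 (mulr_gt0 (divr_gt0 e0 (ltr0Sn R 1)) ln2).
have m2 : 0 < 2 ^+ m :> R by rewrite exprn_gt0.
have /choice[y yP] : forall j : 'I_(2 ^ m), exists x, K x /\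
    exists a, [/\ j%:R < 2 ^+ m * a < j.+1%:R, cx (x - x0) != 0 &
      cy (x - x0) = a * cx (x - x0)].
  move=> j; have [x Kx xs] := dense (ltn_ord j); exists x; split => //.
  have pq : (j%:R / 2 ^+ m : R) < j.+1%:R / 2 ^+ m.
    by rewrite ltr_pM2r ?invr_gt0// ltr_nat.
  have [a /andP[a1 a2] [x1 x2]] := slope_betweenP pq xs; exists a; split => //.
  by rewrite mulrC -ltr_pdivrMr// a1 -ltr_pdivlMr.
have /choice[a aP] : forall j : 'I_(2 ^ m), exists a,
     [/\ j%:R < 2 ^+ m * a < j.+1%:R, cx (y j - x0) != 0 &
      cy (y j - x0) = a * cx (y j - x0)] by move=> j; have [] := yP j.
have aj (j : 'I_(2 ^ m)) : j%:R < 2 ^+ m * a j < j.+1%:R by have [] := aP j.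
pose lam j := cx (y j - x0).
have lam0 j : 0 < `|lam j| by rewrite normr_gt0; have [] := aP j.
have [r r0 rP] := finite_lower_bound lam0.
pose k0 := (Num.truncn (1 + r^-1)).+1.
have k0P : 1 + r^-1 < k0%:R by exact: truncnS_gt.
clearbody k0.
pose c := (k0 + k0).+1.
pose t := (Num.truncn (Num.max (d0^-1) (2 * ln c%:R / (e * ln 2)))).+1.
have tP : Num.max (d0^-1) (2 * ln c%:R / (e * ln 2)) < t%:R by exact: truncnS_gt.
have t0 : (0 < t)%N by [].
clearbody t; move: tP; rewrite gt_max => /andP[t1 t2].
have tm : (t <= t * m)%N by rewrite leq_pmulr.
have tmr : (t%:R : R) <= t%:R * m%:R by rewrite -natrM ler_nat.
pose n := (t * m)%N; pose d : R := (2 ^+ n)^-1.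
have n2 : 0 < 2 ^+ n :> R by rewrite exprn_gt0.
have dgt : 0 < d by rewrite invr_gt0.
have tn : (t%:R : R) < 2 ^+ n.
  by rewrite -natrX ltr_nat (leq_ltn_trans tm)// ltn_expl.
have lnd : - ln d = t%:R * m%:R * ln 2.
  by rewrite /d lnV ?posrE// opprK lnXn// /n -natrM mulr_natl.
exists d.
  rewrite dgt/= lt_min; apply/andP; split.
    by rewrite /d invf_plt ?posrE//; exact: lt_trans tn.
  by rewrite /d invf_lt1// exprn_egt1// ?ltr1n// -lt0n muln_gt0 t0.
move=> n0 [ctr ctrP].
have [N [f [Sf fP]]] := samples n.
have bound (j : 'I_(2 ^ m)) :
   \sum_p (fiber_size (proj_cell f a t j) p)%:R^-1 <= (n0 * c)%:R :> R.
  (* sample points are only near K; moving them within d / 2 into K costs less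
     than one cell *)
  have pos p : exists i : 'I_n0, `|2 ^+ n * (cx (f p) + a j * cy (f p)) -
       2 ^+ n * (ctr i / lam j)| < 1 + r^-1.
    have [p' [Kp' h1 h2]] := S_near (Sf p) (divr_gt0 dgt (ltr0Sn R 1)).
    have [Kyj _] := yP j; have [_ _ cyE] := aP j.
    have : dot_diff_set K x0 (dotr p' (y j - x0)) by exists (p', y j).
    move=> /ctrP[i _]; rewrite -ball_normE/= dotrE cyE -/(lam j) => h3.
    exists i; rewrite -mulrBr normrM gtr0_norm// mulrC -ltr_pdivlMr// -/d.
    have h4 : `|ctr i / lam j - (cx p' + a j * cy p')| < d * r^-1.
      have -> : ctr i / lam j - (cx p' + a j * cy p') =
          (ctr i - (cx p' * lam j + cy p' * (a j * lam j))) / lam j.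
        by field; rewrite -normr_gt0.
      rewrite normrM normfV ltr_pdivrMr//; apply: (lt_le_trans h3).
      by rewrite -mulrA ler_peMr ?(ltW dgt)// ler_pdivlMl// mulr1.
    have /andP[a0 a1] := slope01 (aj j).
    have h5 : `|a j * (cy (f p) - cy p')| <= d / 2.
      rewrite normrM ger0_norm//; apply: (@le_trans _ _ (1 * (d / 2))); last by rewrite mul1r.
      by apply: ler_pM => //; exact: ltW.
    move: h1 h4 h5; rewrite !ltr_norml !ler_norml => /andP[? ?] /andP[? ?] /andP[? ?].
    by rewrite mulrDl mul1r mulrC; apply/andP; split; lra.
  have /choice[i iP] := pos.
  rewrite -[in leRHS](card_ord n0) -[in X in (_ * X)%N](card_ord c) -card_prod.
  apply: (@sum_inv_fiber_size_le _ _ _ _ predT _ (fun p => (i p, inord (absz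
     (proj_cell f a t j p - Num.floor (2 ^+ n * (ctr (i p) / lam j)) + k0%:Z))))).
  have off p := floor_offset (ltW (lt_trans (iP p) k0P)).
  move=> p q _ _ [ipq]; rewrite -ipq => /inord_offset_inj; apply.
    exact: (off p).
  by rewrite ipq; exact: (off q).
have n00 : (0 < n0)%N.
  have /card_gt0P[p _] := sample_nonempty B2 C0 fP; have [p' [Kp' _ _]] := S_near (Sf p) dgt.
  have j0 : (0 < 2 ^ m)%N by rewrite expn_gt0.
  have [Ky _] := yP (Ordinal j0).
  have : dot_diff_set K x0 (dotr p' (y (Ordinal j0) - x0)) by exists (p', y (Ordinal j0)).
  by move=> /ctrP[[i ilt] _ _]; exact: leq_ltn_trans ilt.
have := entropy_bound aj B2 C0 fP bound.
rewrite natrM [ln (n0%:R * _)]lnM ?posrE ?ltr0n// lnd => H.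
have h1 : t%:R * ln (45 * C ^+ 3 * m.+1%:R) <= t%:R * (e / 2 * ln 2 * m%:R).
  by rewrite ler_wpM2l.
have h2 : 2 * ln c%:R < t%:R * (e * ln 2) by rewrite -ltr_pdivrMr// mulr_gt0.
have h3 : t%:R * (e * ln 2) <= t%:R * m%:R * (e * ln 2) by rewrite ler_pM2r// mulr_gt0.
lra.
Qed.

End DenseDirections.

(** * Sets that miss a cone of directions *)

Section PathCover.
Context {R : realType}.

(** Discrete form of the fact that a path is no longer than the total size of
    the intervals that cover it: go to the last point covered by the interval of
    the starting point, take one step, and never use this interval again. *)
Lemma path_cover (U : nat -> R) (M : nat) (cs : seq R) (r d : R) : 0 <= r -> 0 <= d ->
  (forall z, (z <= M)%N -> has (fun c => `|U z - c| <= r) cs) ->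
  (forall z, (z < M)%N -> `|U z.+1 - U z| <= d) ->
  U M - U 0 <= (size cs)%:R * (2 * r + d).
Proof.
move=> r0 d0; move: {2}(size cs) (erefl (size cs)) => n.
elim: n cs U M => [|n IH] cs U M.
  by move=> /size0nil -> /(_ 0 isT).
move=> ncs cov step; have /hasP[c ccs cU0] := cov 0 (leq0n _).
have ex : exists z, (z <= M)%N && (`|U z - c| <= r) by exists 0.
case: (ex_maxnP ex (fun z H => proj1 (andP H))) => z /andP[zM Uz] zmax.
have Uz0 : U z - U 0 <= 2 * r.
  by move: Uz cU0; rewrite !ler_norml => /andP[? ?] /andP[? ?]; lra.
have sn : (size (rem c cs)) = n by rewrite size_rem// ncs.
move: zM; rewrite ncs leq_eqVlt => /orP[/eqP <-|zM].
  apply: (le_trans Uz0); rewrite -natr1 mulrDl mul1r.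
  have : 0 <= n%:R * (2 * r + d) by rewrite mulr_ge0//; lra.
  lra.
have := IH (rem c cs) (fun i => U (z.+1 + i)%N) (M - z.+1)%N sn.
rewrite subnKC// addn0 sn => /(_ _ _)/= H.
have {}H : U M - U z.+1 <= n%:R * (2 * r + d).
  apply: H => i iM; last by rewrite addnS; apply: step; lia.
  have iM' : (z.+1 + i <= M)%N by lia.
  have /hasP[c' c'cs hc'] := cov _ iM'; apply/hasP; exists c' => //.
  have [cc|cc] := eqVneq c' c.
    have : (z.+1 + i <= z)%N by apply: zmax; rewrite iM' -cc.
    lia.
  exact: rem_mem.
have := step z zM; rewrite ler_norml => /andP[_ s2].
rewrite -natr1 mulrDl mul1r; lra.
Qed.

End PathCover.

Section IntervalCovers.
Context {R : realType}.
Implicit Types (A : set R) (l : seq (R * R)).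

Definition interval_cover A l := (forall z, A z -> has (fun I => I.1 <= z <= I.2) l) /\
  all (fun I => I.1 <= I.2) l.

Definition total_length l : R := \sum_(I <- l) (I.2 - I.1).

Lemma interval_cover_refine A (th : R) :
  (forall a b, a <= b -> exists2 l, interval_cover (A `&` [set z | a <= z <= b]) l &
     total_length l <= th * (b - a)) ->
  forall l, interval_cover A l -> exists2 l', interval_cover A l' & total_length l' <= th * total_length l.
Proof.
move=> H l [Al wf]; suff [l' [h1 h2 h3]] : exists l',
    [/\ forall z, A z -> has (fun I => I.1 <= z <= I.2) l -> has (fun I => I.1 <= z <= I.2) l',
        all (fun I : R * R => I.1 <= I.2) l' & total_length l' <= th * total_length l].
  by exists l' => //; split => // z Az; exact: h1 (Al _ Az).
elim: l wf {Al} => [_|[a b] l IH /= /andP[ab wf]].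
  by exists [::]; split => //; rewrite /total_length !big_nil mulr0.
have [l1 [h1 h2 h3]] := IH wf; have [l2 [h4 h5] h6] := H a b ab.
exists (l2 ++ l1); split.
- move=> z Az /orP[abz|lz]; rewrite has_cat; apply/orP; [left|right].
    by apply: h4.
  exact: h1.
- by rewrite all_cat h5.
- rewrite /total_length big_cat big_cons/= mulrDr; exact: lerD.
Qed.

(** If in every interval A can be covered with a saving of the factor th, then
    covering again each interval of a cover saves as much again. *)
Lemma interval_cover_small A (th a b : R) : 0 <= th < 1 -> a <= b ->
  (forall z, A z -> a <= z <= b) ->
  (forall a b, a <= b -> exists2 l, interval_cover (A `&` [set z | a <= z <= b]) l &
     total_length l <= th * (b - a)) ->
  forall e, 0 < e -> exists2 l, interval_cover A l & total_length l <= e.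
Proof.
move=> /andP[t0 t1] ab Aab H e e0.
have it k : exists2 l, interval_cover A l & total_length l <= th ^+ k * (b - a).
  elim: k => [|k [l Al lt]].
    exists [:: (a, b)]; last by rewrite /total_length big_seq1 mul1r.
    by split => /= [z /Aab ->//|]; rewrite ab.
  have [l' Al' lt'] := interval_cover_refine H Al; exists l' => //.
  by apply: (le_trans lt'); rewrite exprS -mulrA ler_wpM2l.
have t1' : `|th| < 1 by rewrite ger0_norm.
have e1 : 0 < e / (b - a + 1) by rewrite divr_gt0//; lra.
have /cvgrPdist_lt/(_ _ e1) := cvg_expr t1'.
move=> [k _ /(_ k (leqnn k))]/=; rewrite sub0r normrN ger0_norm ?exprn_ge0//.
rewrite ltr_pdivlMr; last by lra.
move=> kP; have [l Al lt] := it k; exists l => //; apply: (le_trans lt).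
have : 0 <= th ^+ k by rewrite exprn_ge0.
lra.
Qed.

End IntervalCovers.

Section Extension.
Context {R : realType} {T : Type}.

(** McShane's extension, transported to the line by tau. *)
Lemma lipschitz_extension (E : set T) (tau u : T -> R) (L : R) : 0 <= L -> E !=set0 ->
  (forall x y, E x -> E y -> `|u x - u y| <= L * `|tau x - tau y|) ->
  exists2 v : R -> R, (forall z w, `|v z - v w| <= L * `|z - w|) &
    forall x, E x -> v (tau x) = u x.
Proof.
move=> L0 [x0 Ex0] uL; pose W z := [set u x + L * `|z - tau x| | x in E].
have Wn z : W z !=set0 by exists (u x0 + L * `|z - tau x0|), x0.
have Wlb x z : E x -> lbound (W z) (u x - L * `|z - tau x|).
  move=> Ex _ [y Ey <-]; have := uL _ _ Ex Ey; rewrite ler_norml => /andP[_ h].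
  have : `|tau x - tau y| <= `|z - tau x| + `|z - tau y|.
    by rewrite (distrC z (tau x)) ler_distD.
  move/(ler_wpM2l L0); rewrite mulrDr; lra.
have hlb z : has_lbound (W z) by exists (u x0 - L * `|z - tau x0|); exact: Wlb.
exists (fun z => inf (W z)); last first.
  move=> x Ex; apply/eqP; rewrite eq_le; apply/andP; split.
    apply: (@ge_inf _ (W (tau x)) (hlb _)); exists x => //.
    by rewrite subrr normr0 mulr0 addr0.
  apply: lb_le_inf => //; have := Wlb x (tau x) Ex.
  by rewrite subrr normr0 mulr0 subr0.
have half z w : inf (W z) - L * `|z - w| <= inf (W w).
  apply: lb_le_inf => // _ [x Ex <-].
  have : inf (W z) <= u x + L * `|z - tau x| by apply: ge_inf => //; exists x.
  have := ler_wpM2l L0 (ler_distD w z (tau x)); rewrite mulrDr; lra.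
move=> z w; have := half z w; have := half w z; rewrite (distrC w).
by rewrite ler_norml => h1 h2; apply/andP; split; lra.
Qed.

End Extension.

Section GraphPiece.
Context {R : realType} (s : R) (E : set 'rV[R]_2) (tau : 'rV[R]_2 -> R) (L A : R).
Hypothesis s1 : 1 <= s.
Hypothesis L1 : 1 <= L.
Hypothesis tau_lip : forall x y, `|tau x - tau y| <= 4 * enorm (x - y).
Hypothesis tau_inv : forall x y, E x -> E y -> enorm (x - y) <= L * `|tau x - tau y|.
Hypothesis tau_bnd : forall x, E x -> `|tau x| <= A.
Hypothesis E0 : (0 < hausdorff_measure s E)%E.

(** The pieces of E above the intervals have diameter at most L times their
    length, and r^s <= r for r <= 1. *)
Lemma hausdorff_interval_covers0 :
  (forall e : R, 0 < e -> exists2 l, interval_cover (tau @` E) l & total_length l <= e) ->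
  hausdorff_measure s E = 0%E.
Proof.
have L0 : 0 < L by move: L1; lra.
move=> H; apply: hausdorff_measure0_of_covers => e e0.
pose e' := Num.min e 1; have e'0 : 0 < e' by rewrite lt_min e0 ltr01.
have [l [El wf] lt] := H (e' / L) (divr_gt0 e'0 L0).
pose I i := nth (0, 0) l i : R * R.
pose U i : set 'rV[R]_2 := if (i < size l)%N then E `&` [set x | (I i).1 <= tau x <= (I i).2] else set0.
have I0 i : 0 <= (I i).2 - (I i).1.
  have [il|il] := ltnP i (size l); last by rewrite /I nth_default//= subrr.
  by rewrite subr_ge0; exact: (all_nthP (0, 0) wf).
have totE : total_length l = \sum_(0 <= i < size l) ((I i).2 - (I i).1).
  by rewrite /total_length (big_nth (0, 0)).
have Ie i : L * ((I i).2 - (I i).1) <= e'.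
  rewrite mulrC -ler_pdivlMr//; apply: le_trans lt; rewrite totE.
  have [il|il] := ltnP i (size l); last first.
    by rewrite /I nth_default//= subrr; apply: sumr_ge0 => *; exact: I0.
  rewrite big_mkord (bigD1 (Ordinal il))//= lerDl; apply: sumr_ge0 => *; exact: I0.
have Ud i : (ediam (U i) <= (L * ((I i).2 - (I i).1))%:E)%E.
  rewrite /U; case: ifP => il; last by rewrite ediam0 leNye.
  apply: ge_ereal_sup => _ [[x y] [/= [Ex /andP[x1 x2]] [Ey /andP[y1 y2]]] <-]/=.
  rewrite lee_fin; apply: (le_trans (tau_inv Ex Ey)); rewrite ler_pM2l//.
  by rewrite ler_norml; apply/andP; split; lra.
have Us i : (diam_pow s (U i) <= (L * ((I i).2 - (I i).1))%:E)%E.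
  rewrite /diam_pow; case: ifPn => [_|/set0P[x Ux]]; first by rewrite lee_fin mulr_ge0// ltW.
  move: (Ud i) (Ie i); set r := L * _ => Ur re.
  have U0 : (0 <= ediam (U i))%E.
    apply: ereal_sup_ubound; exists (x, x) => //=.
    by rewrite subrr /enorm dotrE /cx /cy !mxE !mulr0 addr0 sqrtr0.
  have Uf : ediam (U i) \is a fin_num by rewrite ge0_fin_numE// (le_lt_trans Ur)// ltry.
  move: Ur U0; rewrite -(fineK Uf) !lee_fin => Ur U0; apply: le_trans Ur.
  move: U0; rewrite le_eqVlt => /orP[/eqP <-|U0].
    by rewrite powR0// gt_eqF//; move: s1; lra.
  apply: ge1r_powR => //; rewrite U0/=; apply: (le_trans _ (_ : e' <= 1)); last by rewrite ge_min lexx orbT.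
  by rewrite -lee_fin (fineK Uf) (le_trans (Ud i))// lee_fin.
have e'e : e' <= e by rewrite ge_min lexx.
exists U; split.
- move=> x Ex; have /hasP[J Jl Jx] := El (tau x) (imageP tau Ex).
  have il : (index J l < size l)%N by rewrite index_mem.
  by exists (index J l) => //; rewrite /U il /I nth_index.
- by move=> i; apply: (le_trans (Ud i)); rewrite lee_fin (le_trans (Ie i)).
- rewrite (@nneseries_split _ _ 0 (size l)); last first.
    by move=> k _; rewrite /diam_pow; case: ifP => // _; exact: poweR_ge0.
  rewrite [X in (_ + X)%E]eseries0; last first.
    by move=> k kl _; rewrite /U ltnNge kl/= /diam_pow eqxx.
  rewrite adde0 add0n; apply: (@le_trans _ _ (\sum_(0 <= i < size l) (L * ((I i).2 - (I i).1))%:E)%E).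
    by apply: lee_sum => i _; exact: Us.
  rewrite sumEFin -mulr_sumr -totE lee_fin (le_trans _ e'e)//.
  by rewrite mulrC -ler_pdivlMr.
Qed.

Lemma thick_interval th : 0 <= th < 1 -> exists a b, a < b /\
  forall l, interval_cover ((tau @` E) `&` [set z | a <= z <= b]) l -> th * (b - a) < total_length l.
Proof.
move=> th01; apply: contrapT => no; move: E0; rewrite hausdorff_interval_covers0 ?ltxx//.
have [x Ex] : E !=set0.
  by apply/set0P/eqP => E00; move: E0; rewrite E00 hausdorff_measure0 ltxx.
have A0 : 0 <= A by apply: le_trans (tau_bnd Ex).
apply: (@interval_cover_small _ _ th (- A) A) => //.
- lra.
- by move=> _ [y Ey <-]; rewrite -ler_norml; exact: tau_bnd.
- move=> a b; rewrite le_eqVlt => /orP[/eqP ->|ab].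
    exists [:: (b, b)]; last by rewrite /total_length big_seq1/= subrr mulr0.
    by split => [z [_ /= ->]//|]; rewrite /= lexx.
  apply: contrapT => no'; apply: no; exists a, b; split => // l Al.
  by rewrite ltNge; apply/negP => lt; apply: no'; exists l.
Qed.

(** For points x0 and x2 of E above the ends of a well filled interval [a, b], let
    u be the inner product with x2 - x0. The scales are d = L' h, where h divides [a, b] into M
    equal cells and L' is the Lipschitz constant of u in terms of tau: the extension
    v of u moves by at most d from one cell to the next, its value at an occupied
    cell is within 2 d of the center of a covering interval of u(E), and at most
    k M cells are empty; for these the value itself is taken as a center. *)
Lemma graph_piece_cover (K : set 'rV[R]_2) : E `<=` K ->
  exists x0, K x0 /\ forall e d0, 0 < e -> 0 < d0 ->
  exists2 d, 0 < d < Num.min d0 1 &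
    forall n, ball_cover (dot_diff_set K x0) d n -> (1 - e) * - ln d <= ln n%:R.
Proof.
move=> EK; have L0 : 0 < L by move: L1; lra.
(* k is the proportion of [a, b] that tau(E) may leave uncovered, small enough
   for the total loss 7 L' k l to be at most half of |x2 - x0|^2. *)
pose k : R := (128 * L)^-1.
have k0 : 0 < k by rewrite invr_gt0; lra.
have kL : 128 * (k * L) = 1 by rewrite /k; field; rewrite gt_eqF.
have k4 : k <= 1 / 128 by have := ler_peMr (ltW k0) L1; lra.
have [a [b [ab thick]]] : exists a b, a < b /\ forall l,
    interval_cover ((tau @` E) `&` [set z | a <= z <= b]) l -> (1 - k) * (b - a) < total_length l.
  by apply: thick_interval; apply/andP; split; lra.
clearbody k.
pose l := b - a; have l0 : 0 < l by rewrite subr_gt0.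
(* without points near the end a, the rest of [a, b] would be a cover that is
   too short. *)
have [x0 Ex0 /andP[x0a x0b]] : exists2 x, E x & a <= tau x <= a + k * l.
  apply: contrapT => no; have := thick [:: (a + k * l, b)].
  rewrite /total_length big_seq1/= -/l => H.
  suff : (1 - k) * l < b - (a + k * l) by rewrite /l; lra.
  apply: H; split => /=; last by rewrite andbT /l; nra.
  move=> _ [[x Ex <-] /andP[h1 h2]]; rewrite h2 orbF andbT leNgt; apply/negP => h.
  by apply: no; exists x => //; rewrite h1/= ltW.
have [x2 Ex2 /andP[x2a x2b]] : exists2 x, E x & b - k * l <= tau x <= b.
  apply: contrapT => no; have := thick [:: (a, b - k * l)].
  rewrite /total_length big_seq1/= -/l => H.
  suff : (1 - k) * l < b - k * l - a by rewrite /l; lra.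
  apply: H; split => /=; last by rewrite andbT /l; nra.
  move=> _ [[x Ex <-] /andP[h1 h2]]; rewrite h1 orbF leNgt; apply/negP => h.
  by apply: no; exists x => //; rewrite h2 andbT ltW.
exists x0; split; first exact: EK.
pose e := x2 - x0; pose u x := dotr x e.
have le8 : l <= 8 * enorm e.
  have := tau_lip x2 x0; rewrite -/e ler_norml => /andP[_]; rewrite /l in x0b x2a *; nra.
have ne0 : 0 < enorm e by lra.
pose L' := L * enorm e; have L'0 : 0 < L' by rewrite mulr_gt0.
have uB x y : u x - u y = dotr (x - y) e by rewrite /u !dotrE cxB cyB; ring.
have uL x y : E x -> E y -> `|u x - u y| <= L' * `|tau x - tau y|.
  move=> Ex Ey; rewrite uB (le_trans (dotr_le_enorm _ _))// /L' mulrAC.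
  by rewrite ler_pM2r//; exact: tau_inv.
have [v vL vE] := lipschitz_extension (ltW L'0) (ex_intro _ x0 Ex0) uL.
have ue : u x2 - u x0 = enorm e ^+ 2 by rewrite uB enorm_sqr dotrE !expr2.
have far : enorm e ^+ 2 <= v b - v a + 2 * (L' * (k * l)).
  have h1 := vL (tau x0) a; have h2 := vL b (tau x2).
  have h3 : L' * `|tau x0 - a| <= L' * (k * l).
    by rewrite ler_pM2l// ler_norml; apply/andP; split; rewrite /l in x0b *; nra.
  have h4 : L' * `|b - tau x2| <= L' * (k * l).
    by rewrite ler_pM2l// ler_norml; apply/andP; split; rewrite /l in x2a *; nra.
  move: h1 h2; rewrite !vE// -ue !ler_norml => /andP[? ?] /andP[? ?]; lra.
have small : 7 * (L' * (k * l)) <= enorm e ^+ 2 / 2.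
  have -> : 7 * (L' * (k * l)) = 7 * (k * L) * enorm e * l by rewrite /L'; ring.
  have -> : k * L = 128^-1 by lra.
  have : enorm e * l <= enorm e * (8 * enorm e) by rewrite ler_pM2l.
  have : 0 < enorm e * enorm e by rewrite mulr_gt0.
  rewrite expr2; lra.
move=> eps d0 eps0 d00; pose c1 := enorm e ^+ 2 / 20.
have c10 : 0 < c1 by rewrite divr_gt0// exprn_gt0.
pose d1 := Num.min (Num.min d0 1) (expR (ln c1 / eps)).
have d10 : 0 < d1 by rewrite !lt_min d00 ltr01 expR_gt0.
pose M := (Num.truncn (L' * l / d1)).+1.
have MP : L' * l / d1 < M%:R by exact: truncnS_gt.
have M0 : (0 < M)%N by [].
clearbody M; have M0r : (0 : R) < M%:R by rewrite ltr0n.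
pose h := l / M%:R; have h0 : 0 < h by rewrite divr_gt0.
have Mh : M%:R * h = l by rewrite /h mulrC divfK// gt_eqF.
pose d := L' * h; have dgt : 0 < d by rewrite mulr_gt0.
have dd1 : d < d1 by rewrite /d /h mulrA ltr_pdivrMr// [ltRHS]mulrC -ltr_pdivrMr.
move: dd1; rewrite !lt_min => /andP[/andP[dd0 d1'] dexp].
exists d; first by rewrite dgt lt_min dd0.
move=> n [ctr ctrP].
have n0 : (0 < n)%N.
  have : dot_diff_set K x0 (u x2) by exists (x2, x2) => //; split; exact: EK.
  by move=> /ctrP[[i ilt] _ _]; exact: leq_ltn_trans ilt.
pose U z := v (a + z%:R * h).
pose cell z (x : 'rV[R]_2) := E x /\ a + z%:R * h <= tau x <= a + z.+1%:R * h.
pose occ (z : 'I_M) := `[< exists x, cell z x >].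
have occM : (#|[pred z | ~~ occ z]|%:R : R) <= k * M%:R.
  have cov : interval_cover ((tau @` E) `&` [set z | a <= z <= b])
      [seq (a + (nat_of_ord z)%:R * h, a + z.+1%:R * h) | z <- enum occ].
    split; last first.
      by rewrite all_map; apply/allP => z _ /=; rewrite -natr1 mulrDl; lra.
    move=> _ [[x Ex <-] /andP[ax xb]].
    have tx0 : 0 <= (tau x - a) / h by rewrite divr_ge0 ?(ltW h0)// subr_ge0.
    have /andP[t1 t2] := truncn_itv tx0.
    have tM : (tau x - a) / h <= M%:R.
      by rewrite ler_pdivrMr// Mh /l; lra.
    have [z [zM zx]] : exists z, (z < M)%N /\ a + z%:R * h <= tau x <= a + z.+1%:R * h.
      have [tM'|tM'] := ltnP (Num.truncn ((tau x - a) / h)) M.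
        exists (Num.truncn ((tau x - a) / h)); split => //.
        by rewrite ler_pdivlMr// in t1; rewrite ltr_pdivrMr// in t2; apply/andP; split; lra.
      (* the end b belongs to the last cell *)
      exists M.-1; rewrite prednK//; split => //.
      have tE : tau x = b.
        have : (M%:R : R) <= (tau x - a) / h by apply: le_trans t1; rewrite ler_nat.
        by rewrite ler_pdivlMr// Mh /l; lra.
      have -> : (M.-1%:R : R) = M%:R - 1 by rewrite -[in RHS](prednK M0) -natr1; lra.
      by rewrite tE mulrBl Mh /l; apply/andP; split; lra.
    apply/hasP; exists (a + z%:R * h, a + z.+1%:R * h) => //.
    apply/mapP; exists (Ordinal zM) => //; rewrite mem_enum unfold_in /occ.
    by apply/asboolP; exists x.
  have := thick _ cov.
  rewrite /total_length big_map.
  rewrite (eq_bigr (fun=> h)); last by move=> z _ /=; rewrite -natr1; lra.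
  rewrite big_const_seq count_predT -cardE iter_addr_0 -[ltRHS]mulr_natl -/l -Mh mulrA ltr_pM2r//.
  have := cardC occ; rewrite card_ord => /(congr1 (fun n => n%:R : R)); rewrite natrD.
  rewrite (_ : #|[predC occ]| = #|[pred z | ~~ occ z]|); first by lra.
  by apply: eq_card.
pose cs := [seq ctr i | i <- enum 'I_n] ++
  [seq U (nat_of_ord z) | z <- enum [pred z | ~~ occ z]] ++ [:: U M].
have cssz : size cs = (n + (#|[pred z | ~~ occ z]| + 1))%N.
  by rewrite /cs !size_cat !size_map -?cardE -enumT size_enum_ord.
have step z : `|U z.+1 - U z| <= d.
  apply: (le_trans (vL _ _)); rewrite /d ler_pM2l//.
  by rewrite -natr1 mulrDl mul1r opprD addrACA subrr add0r addrAC subrr add0r gtr0_norm.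
have cov z : (z <= M)%N -> has (fun c => `|U z - c| <= 2 * d) cs.
  rewrite leq_eqVlt => /orP[/eqP ->|zM].
    by rewrite !has_cat/= subrr normr0 mulr_ge0 ?(ltW dgt)// !orbT.
  have [zo|zo] := boolP (occ (Ordinal zM)); last first.
    apply/hasP; exists (U z); last by rewrite subrr normr0 mulr_ge0 ?(ltW dgt).
    rewrite !mem_cat; apply/orP; right; apply/orP; left; apply/mapP.
    by exists (Ordinal zM) => //; rewrite mem_enum.
  move: zo => /asboolP[x [Ex /andP[/= zx xz]]].
  have : dot_diff_set K x0 (u x) by exists (x, x2) => //; split; exact: EK.
  move=> /ctrP[i _]; rewrite -ball_normE/= => ui.
  apply/hasP; exists (ctr i); first by rewrite mem_cat map_f// mem_enum.
  have h1 : `|U z - u x| <= d.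
    rewrite -(vE x Ex); apply: (le_trans (vL _ _)); rewrite /d ler_pM2l//.
    rewrite -natr1 in xz; rewrite ler_norml; apply/andP; split; lra.
  move: ui h1; rewrite ltr_norml !ler_norml => /andP[? ?] /andP[? ?]; apply/andP; split; lra.
have d2 : 0 <= 2 * d by rewrite mulr_ge0 ?(ltW dgt).
have := path_cover d2 (ltW dgt) cov (fun z _ => step z).
rewrite cssz /U mul0r addr0 Mh (_ : a + l = b); last by rewrite /l; lra.
rewrite !natrD.
set m := #|_| in occM *.
have md : m%:R * d <= L' * (k * l).
  rewrite -Mh [leRHS](_ : _ = k * M%:R * d); last by rewrite /d; ring.
  by rewrite ler_pM2r.
have n1 : (1 : R) <= n%:R by rewrite ler1n.
have nd : d <= n%:R * d by rewrite ler_peMl// ltW.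
move=> pc.
have c1n : c1 <= n%:R * d.
  rewrite /c1.
  have : (n%:R + (m%:R + 1)) * (2 * (2 * d) + d) = 5 * (n%:R * d) + 5 * (m%:R * d) + 5 * d by ring.
  lra.
have lnc : ln c1 <= ln n%:R + ln d.
  have nd0 : 0 < n%:R * d by rewrite mulr_gt0// ltr0n.
  by rewrite -lnM ?posrE ?ltr0n// ler_ln ?posrE.
have lnd : eps * ln d <= ln c1.
  have : ln d < ln c1 / eps by rewrite -[ltRHS]expRK ltr_ln ?posrE ?expR_gt0.
  by rewrite ltr_pdivlMr// mulrC => /ltW.
lra.
Qed.

End GraphPiece.

(** * Conclusion *)

Section Cones.
Context {R : realType}.
Implicit Types (p q : R) (u x y : 'rV[R]_2).

(** With v and w the two factors of [slope_between], tilt = v - w; off the cone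
    v and w have opposite signs, and then |v - w| = |v| + |w| controls u. *)
Definition tilt p q u : R := (cy u - p * cx u) - (q * cx u - cy u).

Lemma tiltB p q x y : tilt p q x - tilt p q y = tilt p q (x - y).
Proof. by rewrite /tilt cxB cyB; ring. Qed.

Lemma tilt_le p q u : 0 <= p <= 1 -> 0 <= q <= 1 -> `|tilt p q u| <= 4 * enorm u.
Proof.
move=> /andP[p0 p1] /andP[q0 q1].
have h1 := cx_le_enorm u; have h2 := cy_le_enorm u.
have -> : tilt p q u = 2 * cy u - (p + q) * cx u by rewrite /tilt; ring.
apply: (le_trans (ler_normB _ _)); rewrite !normrM (ger0_norm (_ : 0 <= 2))//.
rewrite (ger0_norm (addr_ge0 p0 q0)).
have : (p + q) * `|cx u| <= 2 * `|cx u| by rewrite ler_wpM2r//; lra.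
lra.
Qed.

Lemma enorm_le_tilt p q u : 0 <= p <= 1 -> 0 <= q <= 1 -> p < q ->
  ~ slope_between p q u -> enorm u <= 3 / (q - p) * `|tilt p q u|.
Proof.
move=> /andP[p0 p1] /andP[q0 q1] pq /negP; rewrite -leNgt.
set v := cy u - _; set w := _ - cy u => vw.
have qp : 0 < q - p by lra.
have tE : `|tilt p q u| = `|v| + `|w|.
  rewrite /tilt -/v -/w; have [v0|v0] := leP 0 v; have [w0|w0] := leP 0 w.
  - have [->|vn0] := eqVneq v 0; first by rewrite sub0r normrN normr0 add0r.
    have -> : w = 0 by have : 0 < v by [rewrite lt_def vn0]; nra.
    by rewrite subr0 normr0 addr0.
  - by rewrite (ger0_norm v0) (ltr0_norm w0) ger0_norm//; lra.
  - by rewrite (ltr0_norm v0) (ger0_norm w0) ltr0_norm//; lra.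
  - by nra.
have cxE : (q - p) * `|cx u| <= `|tilt p q u|.
  rewrite -(gtr0_norm qp) -normrM tE [X in `|X|](_ : _ = v + w); last by rewrite /v /w; ring.
  exact: ler_normD.
have cyE : `|cy u| <= `|tilt p q u| + `|cx u|.
  have -> : cy u = v + p * cx u by rewrite /v; ring.
  apply: (le_trans (ler_normD _ _)); rewrite tE normrM (ger0_norm p0).
  have : p * `|cx u| <= `|cx u| by rewrite ler_piMl.
  have := normr_ge0 w; lra.
rewrite mulrAC ler_pdivlMr// mulrC.
apply: (@le_trans _ _ ((q - p) * (`|cx u| + `|cy u|))).
  by rewrite ler_pM2l//; exact: enorm_le_sum.
have h1 : (q - p) * `|cy u| <= (q - p) * (`|tilt p q u| + `|cx u|) by rewrite ler_pM2l.
have h2 : (q - p) * `|tilt p q u| <= `|tilt p q u| by rewrite ler_piMl//; lra.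
lra.
Qed.

Lemma bounded_coord (K : set 'rV[R]_2) : bounded_set K ->
  exists2 A : R, 0 <= A & forall x, K x -> `|cx x| <= A /\ `|cy x| <= A.
Proof.
move=> [M [_ HM]]; pose A := Num.max (M + 1) 0 + 1.
have A0 : 0 < A by rewrite ltr_pwDr// le_max lexx orbT.
exists A; first exact: ltW.
move=> x Kx; have : `|x| <= A - 1.
  by apply: HM => //; rewrite /A addrK lt_max ltrDl ltr01.
move=> xA; have : ball 0 A x by rewrite -ball_normE/= sub0r normrN; lra.
move=> /(ball_coordP _ _ A0)[].
by rewrite -cxB -cyB sub0r /cx /cy !mxE !normrN => /ltW ? /ltW.
Qed.

Lemma bounded_dot_diff (K : set 'rV[R]_2) x0 : bounded_set K -> K x0 ->
  exists2 A : R, 0 <= A & forall z : R, dot_diff_set K x0 z -> `|z| <= A.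
Proof.
move=> /bounded_coord[A A0 KA] Kx0; exists (2 * A * (4 * A)); first by rewrite !mulr_ge0.
move=> _ [[x y] [/= Kx Ky] <-].
have [h1 h2] := KA _ Kx; have [h3 h4] := KA _ Ky; have [h5 h6] := KA _ Kx0.
apply: (le_trans (dotr_le_enorm _ _)); apply: ler_pM; rewrite ?enorm_ge0//.
  by apply: (le_trans (enorm_le_sum _)); lra.
apply: (le_trans (enorm_le_sum _)); rewrite cxB cyB.
have := ler_normB (cx y) (cx x0); have := ler_normB (cy y) (cy x0); lra.
Qed.

End Cones.

Theorem theorem5p1 (R : realType) (s : R) (K : set 'rV[R]_2) :
  1 <= s ->
  K !=set0 ->
  bounded_set K ->
  (hausdorff_measure s).-caratheodory K ->
  AD_regular_set s K ->
  exists2 x0 : 'rV[R]_2, K x0 &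
    upper_box_dim (dot_diff_set K x0) = 1%E.
Proof.
move=> s1 K0 bK _ [C C1 [_ HK AD]].
(* both cases provide covering estimates of the same form *)
suff [x0 [Kx0 big]] : exists x0, K x0 /\ forall e d0, 0 < e -> 0 < d0 ->
    exists2 d, 0 < d < Num.min d0 1 &
      forall n, ball_cover (dot_diff_set K x0) d n -> (1 - e) * - ln d <= ln n%:R.
  exists x0 => //; have [A A0 KA] := bounded_dot_diff bK Kx0.
  apply/eqP; rewrite eq_le (upper_box_dim_le1 A0 KA)/=.
  exact: upper_box_dim_ge1 A0 KA big.
have [[x0 [Kx0 dense]]|sparse] := pselect (exists x0, K x0 /\ forall m j, (j < 2 ^ m)%N ->
    exists2 x, K x & slope_between (j%:R / 2 ^+ m) (j.+1%:R / 2 ^+ m) (x - x0)).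
  exists x0; split => //.
  have [D D0 DP] := AD_dyadic s1 C1 AD HK.
  have /andP[HK0 HKoo] := HK.
  have HKf : hausdorff_measure s K \is a fin_num.
    by rewrite ge0_fin_numE// hausdorff_measure_ge0.
  have h0 : 0 < fine (hausdorff_measure s K) by rewrite fine_gt0// HK0.
  have hE : hausdorff_measure s K = (fine (hausdorff_measure s K))%:E by rewrite fineK.
  have samples := regular_sample_exists D0 h0 hE (fun x l Sx => (DP x l Sx).1) (fun x l Sx => (DP x l Sx).2).
  move=> e d0 e0 d00.
  apply: (dense_directions_cover _ _ (@support_approx R s K) samples dense e0 d00).
    by apply: le1r_powR => //; rewrite ler1n.
  have B0 : 0 < 2 `^ s by rewrite powR_gt0.
  by rewrite !addr_gt0// ?divr_gt0// !mulr_gt0// exprn_gt0.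
(* E m j is the set of points of K that see no point of K with slope in the j-th
   interval of level m; these sets cover K. *)
pose E m j : set 'rV[R]_2 := [set x0 | [/\ K x0, (j < 2 ^ m)%N & forall x, K x ->
  ~ slope_between (j%:R / 2 ^+ m) (j.+1%:R / 2 ^+ m) (x - x0)]].
have [m [j E0]] : exists m j, (0 < hausdorff_measure s (E m j))%E.
  apply: contrapT => no; have /andP[HK0 _] := HK; move: HK0.
  pose F n := if unpickle n is Some c then E c.1 c.2 else set0.
  rewrite (@hausdorff_cover0 _ _ F) ?ltxx// => [n|x Kx].
    rewrite /F; case: unpickle => [[m j]|]; last exact: hausdorff_measure0.
    apply/eqP; rewrite eq_le hausdorff_measure_ge0 andbT leNgt; apply/negP => Emj.
    by apply: no; exists m, j.
  apply: contrapT => nF; apply: sparse; exists x; split => // m j jm.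
  apply: contrapT => nx; apply: nF; exists (pickle (m, j)) => //; rewrite /F pickleK /=.
  by split => // y Ky sy; apply: nx; exists y.
have [x Emx] : E m j !=set0.
  by apply/set0P/eqP => E00; move: E0; rewrite E00 hausdorff_measure0 ltxx.
have [_ jm _] := Emx.
pose p : R := j%:R / 2 ^+ m; pose q : R := j.+1%:R / 2 ^+ m.
have m0 : 0 < 2 ^+ m :> R by rewrite exprn_gt0.
have pq : p < q by rewrite ltr_pM2r ?invr_gt0// ltr_nat.
have p0 : 0 <= p by rewrite divr_ge0 ?exprn_ge0.
have q1 : q <= 1 by rewrite ler_pdivrMr// mul1r -natrX ler_nat.
have p01 : 0 <= p <= 1 by apply/andP; split; lra.
have q01 : 0 <= q <= 1 by apply/andP; split; lra.
have [A A0 KA] := bounded_coord bK.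
apply: (@graph_piece_cover R s (E m j) (tilt p q) (3 / (q - p)) (4 * (2 * A))) => //.
- by rewrite ler_pdivlMr; lra.
- by move=> y z; rewrite tiltB; exact: tilt_le.
- move=> y z [Ky _ Ey] [Kz _ Ez]; rewrite tiltB; apply: enorm_le_tilt => //.
  exact: Ez.
- move=> y [Ky _ _]; apply: (le_trans (tilt_le _ p01 q01)); rewrite ler_pM2l//.
  have [h1 h2] := KA _ Ky; apply: (le_trans (enorm_le_sum _)); lra.
- by move=> y [].
Qed.
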